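(* Let $1<p<\infty$, $\alpha\in(-1,0)$ and $\beta<|\alpha|p-1$, and put $s:=\frac{\beta+1-|\alpha|p}{p}$. Let $$W(\alpha,\beta):=\{u\in W^{1,p}(\mathbb{R}_+,t^\beta):\ \liminf_{t\to0^+}|u(t)|\,t^{s}=0\}.$$ Then $W(\alpha,\beta)=W_0^{1,p}(\mathbb{R}_+,t^\beta)$; in particular the set $W(\alpha,\beta)$ is independent of $\alpha$.
   Context: $\mathbb{R}_+=(0,\infty)$; functions are real valued. $W^{1,p}(\mathbb{R}_+,t^\beta)$ is the Banach space of all $u\in W^{1,1}_{loc}(\mathbb{R}_+)$ with finite norm $$\|u\|_{W^{1,p}(\mathbb{R}_+,t^\beta)}=\Big(\int_{\mathbb{R}_+}|u(t)|^pt^\beta dt\Big)^{1/p}+\Big(\int_{\mathbb{R}_+}|u'(t)|^pt^\beta dt\Big)^{1/p}.$$ Elements of $W^{1,1}_{loc}(\mathbb{R}_+)$ are identified with their continuous representatives on $\mathbb{R}_+$. $W_0^{1,p}(\mathbb{R}_+,t^\beta)$ denotes the completion (closure) of $C_0^\infty(\mathbb{R}_+)$, the smooth functions with compact support in $(0,\infty)$, in $W^{1,p}(\mathbb{R}_+,t^\beta)$. *)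

(* Defs.v *)
From HB Require Import structures.
From mathcomp Require Import all_boot all_order all_algebra.
From mathcomp Require Import all_classical all_reals all_analysis.
Set Implicit Arguments.
Unset Strict Implicit.
Unset Printing Implicit Defensive.
Import Order.TTheory GRing.Theory Num.Theory.
Import numFieldNormedType.Exports.
Local Open Scope classical_set_scope.
Local Open Scope ring_scope.

(* A function on the open half-line (0, +oo) is represented by a total function
   R -> R. Its values on ]-oo, 0] are irrelevant: every notion below depends
   only on the restriction to (0, +oo), except that test functions are taken
   extended by 0 to the whole line. *)
Definition Rplus (R : realType) : set R := [set t | 0 < t].

Definition test_fun (R : realType) (phi : R -> R) : Prop :=
  [/\ forall n t, derivable (derive1n n phi) t 1,
      compact (closure [set t | phi t != 0]) &
      closure [set t | phi t != 0] `<=` @Rplus R].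

Definition is_weak_deriv (R : realType) (u v : R -> R) : Prop :=
  locally_integrable (@Rplus R) v /\
  forall phi : R -> R, test_fun phi ->
    \int[lebesgue_measure]_(t in @Rplus R) (u t * derive1 phi t) =
    - \int[lebesgue_measure]_(t in @Rplus R) (v t * phi t).

(* A chosen version of the a.e. unique weak derivative u' (junk value 0 when u
   has no weak derivative). *)
Definition weak_deriv (R : realType) (u : R -> R) : R -> R :=
  xget (fun=> 0) [set v | is_weak_deriv u v].

(* The continuous representatives of the elements of W^{1,1}_loc(0, +oo). *)
Definition W11loc (R : realType) : set (R -> R) :=
  [set u | [/\ {within @Rplus R, continuous u},
               locally_integrable (@Rplus R) u &
               exists v, is_weak_deriv u v]].

Definition wLp_norm (R : realType) (p beta : R) (f : R -> R) : \bar R :=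
  ((\int[lebesgue_measure]_(t in @Rplus R) (`|f t| `^ p * t `^ beta)%:E)
     `^ p^-1)%E.

Definition W1p_norm (R : realType) (p beta : R) (u : R -> R) : \bar R :=
  (wLp_norm p beta u + wLp_norm p beta (weak_deriv u))%E.

Definition W1p (R : realType) (p beta : R) : set (R -> R) :=
  [set u | W11loc u /\ (W1p_norm p beta u < +oo)%E].

(* The closure, in W1p p beta, of the set of test functions. *)
Definition W1p0 (R : realType) (p beta : R) : set (R -> R) :=
  [set u | W1p p beta u /\
     forall e : R, 0 < e ->
       exists2 phi, test_fun phi & (W1p_norm p beta (u \- phi)%R < e%:E)%E].

Definition sexp (R : realType) (p alpha beta : R) : R :=
  (beta + 1 - `|alpha| * p) / p.

Definition Wab (R : realType) (p alpha beta : R) : set (R -> R) :=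
  [set u | W1p p beta u /\
     limf_einf (fun t : R => (`|u t| * t `^ sexp p alpha beta)%:E) 0^'+ = 0%E].

(* Main.v *)
Require Import Defs.
From HB Require Import structures.
From mathcomp Require Import all_boot all_order all_algebra.
From mathcomp Require Import ring lra.
From mathcomp Require Import all_classical all_reals all_analysis.
From mathcomp Require Import measurable_realfun.
Set Implicit Arguments.
Unset Strict Implicit.
Unset Printing Implicit Defensive.
Import Order.TTheory GRing.Theory Num.Theory.
Import numFieldNormedType.Exports.
Local Open Scope classical_set_scope.
Local Open Scope ring_scope.

(** Both sets consist of the [u] in [W1p p beta] that vanish at [0]; this condition
does not involve [alpha].

Since [`|alpha| < 1], the hypothesis gives [beta < p - 1], so that the function
[t `^ (- beta / (p - 1))] is integrable near [0]. For [d > 0] one has pointwise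
  [`|x| <= d * t `^ (- beta / (p - 1)) + d `^ (1 - p) * (`|x| `^ p * t `^ beta)]
([powR_young]). Integrated against the weak derivative [v] of [u]
([young_integral], [weak_deriv_FTC_le]) and with [d] chosen as a power of [t], it
yields the estimate [hardy_bound]: if an element [u] of [W1p p beta] takes
arbitrarily small values arbitrarily near [0], then [`|u t|] is at most
[t `^ ((p - 1 - beta) / p)] times a factor that tends to [0] with [t].

An element [u] of the closure is the limit of test functions uniformly on
[`]0, 1]] ([sup_bound]), hence is small near [0] ([W1p0_small_near0]); multiplying
[hardy_bound] by [t `^ sexp p alpha beta] leaves the power
[t `^ (1 - `|alpha|)], which tends to [0] ([W1p0_sub_Wab]). Conversely
[sexp p alpha beta < 0], so a vanishing lower limit forces small values of [u]
near [0] ([Wab_sub_W1p0]). Then [hardy_bound] makes the energy of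
[u * derive1 chi] small for a cutoff [chi] that vanishes near [0] and near
infinity ([cutoff_energy]). The product [u * chi] has compact support in the open
half-line; its weak derivative is approximated by a smooth function whose integral
is corrected to [0], and the primitive of the latter is the test function sought
([compact_density]).

Throughout, weak derivatives are handled through the identity
[u t - u s = \int[mu]_(x in `[s, t]) v x] ([weak_deriv_FTC]), which also gives
their uniqueness almost everywhere ([weak_deriv_ae]). *)

(** * Smooth functions *)

Section Smooth.
Variable R : realType.
Implicit Types (f g : R -> R) (n k : nat) (t x a b : R).

(** [ndiff n f] is [n]-fold differentiability; peeling derivatives off from the
inside lets closure properties be proved by induction on [n] for all functions
at once. *)
Fixpoint ndiff n f : Prop :=
  if n is m.+1 then (forall t, derivable f t 1) /\ ndiff m (derive1 f) else True.

Definition smooth f := forall n, ndiff n f.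

Lemma smoothP f : smooth f <-> forall n t, derivable (derive1n n f) t 1.
Proof.
split=> [sf n|].
  have : ndiff n.+1 f by exact: sf.
  elim: n f {sf} => [|n IH] f [df sf] t; first exact: df.
  by rewrite derive1Sn; exact: IH.
move=> + n; elim: n f => [//|n IH] f df; split; first exact: (df 0%N).
by apply: IH => k t; rewrite -derive1Sn.
Qed.

Lemma ndiff_is_derive n f df :
  (forall t, is_derive t (1 : R) f (df t)) -> ndiff n df -> ndiff n.+1 f.
Proof.
move=> fdf; have -> : df = derive1 f.
  by apply/funext => t; rewrite derive1E; apply/esym/derive_val.
by split.
Qed.

Lemma smooth_derivable f t : smooth f -> derivable f t 1.
Proof. by move=> /(_ 1%N)[]. Qed.

Lemma smooth_derive f : smooth f -> smooth (derive1 f).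
Proof. by move=> sf n; have [] := sf n.+1. Qed.

Lemma smooth_continuous f : smooth f -> continuous f.
Proof.
by move=> sf t; apply/differentiable_continuous/derivable1_diffP/smooth_derivable.
Qed.

Lemma smooth_is_derive f t : smooth f -> is_derive t (1 : R) f (derive1 f t).
Proof. by move=> sf; rewrite derive1E; apply/derivableP/smooth_derivable. Qed.

Lemma smooth_prim f df :
  (forall t, is_derive t (1 : R) f (df t)) -> smooth df -> smooth f.
Proof. by move=> fdf sdf [//|n]; apply: ndiff_is_derive fdf (sdf n). Qed.

Lemma ndiffW n f : ndiff n.+1 f -> ndiff n f.
Proof.
by elim: n f => [//|n IH] f [df sf]; split => //; exact: IH.
Qed.

Lemma ndiff_cst n (c : R) : ndiff n (fun=> c).
Proof.
elim: n c => [//|n IH] c; apply: (@ndiff_is_derive _ _ (fun=> 0)) => // t.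
Qed.

Lemma ndiffD n f g : ndiff n f -> ndiff n g -> ndiff n (fun x => f x + g x).
Proof.
elim: n f g => [//|n IH] f g [df sf] [dg sg].
apply: (@ndiff_is_derive _ _ (fun x => derive1 f x + derive1 g x)); last exact: IH.
by move=> t; apply: is_deriveD; rewrite derive1E; apply/derivableP.
Qed.

(** The Leibniz rule lowers the order of one factor only, which is why the
induction needs [ndiffW]. *)
Lemma ndiffM n f g : ndiff n f -> ndiff n g -> ndiff n (fun x => f x * g x).
Proof.
elim: n f g => [//|n IH] f g nf ng.
have [df sf] := nf; have [dg sg] := ng.
apply: (@ndiff_is_derive _ _ (fun x => f x * derive1 g x + g x * derive1 f x)).
  by move=> t; apply: is_deriveM; rewrite derive1E; apply/derivableP.
by apply: ndiffD; apply: IH => //; exact: ndiffW.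
Qed.

Lemma smooth_cst (c : R) : smooth (fun=> c).
Proof. by move=> n; exact: ndiff_cst. Qed.

Lemma smoothD f g : smooth f -> smooth g -> smooth (fun x => f x + g x).
Proof. by move=> sf sg n; apply: ndiffD. Qed.

Lemma smoothM f g : smooth f -> smooth g -> smooth (fun x => f x * g x).
Proof. by move=> sf sg n; apply: ndiffM. Qed.

Lemma smoothZ (c : R) f : smooth f -> smooth (fun x => c * f x).
Proof. by apply: smoothM; exact: smooth_cst. Qed.

Lemma smoothB f g : smooth f -> smooth g -> smooth (fun x => f x - g x).
Proof.
move=> sf sg; have -> : (fun x => f x - g x) = (fun x => f x + (-1) * g x).
  by apply/funext => x; rewrite mulN1r.
by apply: smoothD => //; exact: smoothZ.
Qed.

Lemma is_derive_affine f t (a b df : R) : is_derive (a * t + b) (1 : R) f df ->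
  is_derive t (1 : R) (fun x => f (a * x + b)) (a * df).
Proof.
move=> fd.
have h : is_derive t (1 : R) (fun x : R => a * x + b) a.
  have -> : (fun x : R => a * x + b) = (a \*: (id : R -> R)) \+ cst b by [].
  by apply: is_derive_eq; rewrite addr0 /GRing.scale /= mulr1.
rewrite [a * df]mulrC.
exact: (@is_derive1_comp _ f (fun x : R => a * x + b) t df a).
Qed.

Lemma smooth_affine f a b : smooth f -> smooth (fun x => f (a * x + b)).
Proof.
move=> sf n; elim: n f sf => [//|n IH] f sf.
apply: (@ndiff_is_derive _ _ (fun x => a * derive1 f (a * x + b))).
  by move=> t; apply: is_derive_affine; exact: smooth_is_derive.
apply: ndiffM; first exact: ndiff_cst.
by apply: IH; exact: smooth_derive.
Qed.

End Smooth.
(** * The flat function exp(-1/x) *)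

Section Flat.
Variable R : realType.
Implicit Types (f g : R -> R) (n k : nat) (t x a b : R).

(** Differentiability at the point where [flat] is glued to [0]: a quadratic bound
forces the derivative to vanish there. *)
Lemma is_derive_quad f (C : R) : (forall h, `|f h| <= C * h ^+ 2) ->
  is_derive (0 : R) (1 : R) f 0.
Proof.
move=> fC.
have f0 : f 0 = 0.
  by apply/normr0_eq0/eqP; rewrite eq_le normr_ge0 andbT (le_trans (fC 0))// expr0n mulr0.
have C0 : 0 <= C by have := le_trans (normr_ge0 _) (fC 1); rewrite expr1n mulr1.
have lim0 : (fun h : R => h^-1 *: (f (h *: 1 + 0) - f 0)) @ 0^' --> (0 : R).
  apply/cvgr0Pnorm_le => e e0.
  near=> h.
  have hn0 : h != 0 by near: h; exact: nbhs_dnbhs_neq.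
  rewrite f0 subr0 addr0 [h *: 1]mulr1 normrZ normfV.
  rewrite mulrC ler_pdivrMr ?normr_gt0//.
  apply: (le_trans (fC h)); rewrite -real_normK ?num_real// expr2 mulrA.
  apply: ler_wpM2r => //.
  have : `|h| <= e / (C + 1).
    near: h; apply: dnbhs0_le; apply: divr_gt0 => //; lra.
  rewrite ler_pdivlMr; last by lra.
  have := normr_ge0 h; nra.
have D0 : 'D_1 f 0 = 0 by apply/cvg_lim.
split; last exact: D0.
by apply/cvg_ex; exists 0.
Unshelve. all: by end_near. Qed.

(** The classical function [exp (- 1 / x)], extended by [0], multiplied by a power
of [x^-1]: the family over [k] is closed under differentiation. *)
Definition flat k x : R := if 0 < x then x^-1 ^+ k * expR (- x^-1) else 0.

Lemma flat_ge0 k x : 0 <= flat k x.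
Proof.
rewrite /flat; case: ifPn => // x0.
by rewrite mulr_ge0 ?expR_ge0// exprn_ge0// invr_ge0 ltW.
Qed.

Lemma flat_gt0 k x : 0 < x -> 0 < flat k x.
Proof. by move=> x0; rewrite /flat x0 mulr_gt0 ?expR_gt0// exprn_gt0// invr_gt0. Qed.

Lemma flat_le0 k x : x <= 0 -> flat k x = 0.
Proof. by rewrite /flat ltNge => ->. Qed.

(** With [y = x^-1] this is [y ^+ k.+1 / (k.+1)`! <= expR y], one term of the
exponential series. *)
Lemma flat_le_lin k x : 0 < x -> flat k x <= (k.+1)`!%:R * x.
Proof.
move=> x0; rewrite /flat x0; set y := x^-1.
have y0 : 0 < y by rewrite invr_gt0.
have -> : x = y^-1 by rewrite invrK.
rewrite expRN ler_pdivrMr ?expR_gt0// mulrAC ler_pdivlMr// -exprSr.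
have := @expR_ge1Dxn R y k (ltW y0).
have f0 : 0 < (k.+1)`!%:R :> R by rewrite ltr0n fact_gt0.
move=> h; rewrite mulrC -ler_pdivrMr//; lra.
Qed.

Lemma is_derive_flat k t :
  is_derive t (1 : R) (flat k) (- k%:R * flat k.+1 t + flat k.+2 t).
Proof.
have [t0|t0|->] := ltgtP t 0.
- rewrite !flat_le0 ?ltW// mulr0 addr0.
  apply: (@near_eq_is_derive _ _ _ (cst 0)) (is_derive_cst _ _ _).
  near=> y; rewrite flat_le0// ltW//; near: y; exact: lt_nbhsl.
- apply: (near_eq_is_derive (f := fun x : R => x^-1 ^+ k * expR (- x^-1))).
    near=> y; rewrite /flat; suff -> : 0 < y by [].
    by near: y; exact: lt_nbhsr.
  have tn : t != 0 by rewrite gt_eqF.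
  have di : is_derive t (1 : R) (fun x : R => x^-1) (- t^-1 ^+ 2).
    have := is_deriveV (f := id) tn (is_derive_id t 1).
    by rewrite /GRing.scale/= mulr1 exprVn.
  have dk : is_derive t (1 : R) (fun x : R => x^-1 ^+ k) (- k%:R * t^-1 ^+ k.+1).
    have -> : (fun x : R => x^-1 ^+ k) = (fun x : R => x^-1) ^+ k.
      by rewrite exprfctE.
    apply: (is_derive_eq (is_deriveX _ di)); case: k => [|k].
      by rewrite /= mulr0n /GRing.scale /= !mul0r oppr0 mul0r.
    by rewrite /= /GRing.scale /= -mulr_natr !exprS; ring.
  have de : is_derive t (1 : R) (fun x : R => expR (- x^-1))
      (t^-1 ^+ 2 * expR (- t^-1)).
    have dn := is_deriveN di.
    have := @is_derive1_comp _ expR (fun x : R => - x^-1) t _ _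
      (is_derive_expR _) dn.
    by rewrite opprK mulrC.
  apply: (is_derive_eq (is_deriveM dk de)).
  by rewrite /flat t0 /GRing.scale /= !exprS; ring.
- rewrite !flat_le0// mulr0 addr0.
  apply: (@is_derive_quad _ (k.+2)`!%:R) => h.
  have [h0|h0] := ltP 0 h; last first.
    by rewrite flat_le0// normr0 mulr_ge0// sqr_ge0.
  rewrite ger0_norm ?flat_ge0//.
  have -> : flat k h = flat k.+1 h * h.
    by rewrite /flat h0 exprS; field; rewrite gt_eqF.
  by rewrite expr2 mulrA ler_wpM2r ?(ltW h0)// flat_le_lin.
Unshelve. all: by end_near. Qed.

Lemma smooth_flat k : smooth (flat k).
Proof.
move=> n; elim: n k => [//|n IH] k.
apply: (ndiff_is_derive (is_derive_flat k)).
by apply: ndiffD => //; apply: ndiffM => //; exact: ndiff_cst.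
Qed.

End Flat.
(** * Smooth steps and primitives *)

Section Step.
Variable R : realType.
Implicit Types (f g : R -> R) (n k : nat) (t x a b : R).
Notation mu := (@lebesgue_measure R).

Lemma continuous_itv_integrable f a b : continuous f ->
  mu.-integrable `[a, b] (EFin \o f).
Proof.
move=> cf; apply: continuous_compact_integrable; first exact: segment_compact.
exact: continuous_subspaceT.
Qed.

Lemma derivable_oo_smooth f a b : smooth f -> derivable_oo_LRcontinuous f a b.
Proof.
move=> sf; split.
- by move=> x _; exact: smooth_derivable.
- by apply: cvg_at_right_filter; exact: smooth_continuous.
- by apply: cvg_at_left_filter; exact: smooth_continuous.
Qed.

Lemma smooth_FTC f a b : a <= b -> smooth f ->
  \int[mu]_(t in `[a, b]) derive1 f t = f b - f a.
Proof.
rewrite le_eqVlt => /predU1P[->|ab] sf.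
  by rewrite set_itv1 Rintegral_set1 subrr.
rewrite /Rintegral (@continuous_FTC2 _ _ f a b)//.
- exact/continuous_subspaceT/smooth_continuous/smooth_derive.
- exact: derivable_oo_smooth.
Qed.

Lemma Rintegral_itv0 f a b : (forall x, a <= x <= b -> f x = 0) ->
  \int[mu]_(t in `[a, b]) f t = 0.
Proof.
move=> f0; rewrite (@eq_Rintegral _ _ _ _ _ (cst 0)).
  by rewrite Rintegral_cst//= mul0r.
by move=> x; rewrite inE/= in_itv/= => /f0.
Qed.

(** The integral is taken from [a - 1] rather than [a], so that every point is
either interior to the range of integration or has a neighbourhood on which the
primitive vanishes. *)
Lemma smooth_primitive a w : smooth w -> (forall x, x <= a -> w x = 0) ->
  exists W, [/\ smooth W, derive1 W = w & forall x, x <= a -> W x = 0].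
Proof.
move=> sw w0; pose W x := \int[mu]_(t in `[a - 1, x]) w t.
have W0 x : x <= a -> W x = 0.
  move=> xa; apply: Rintegral_itv0 => y /andP[_ yx]; apply: w0.
  exact: le_trans yx xa.
have dW x : is_derive x (1 : R) W (w x).
  have [xa|ax] := ltP x a.
    rewrite (w0 _ (ltW xa)).
    apply: (@near_eq_is_derive _ _ _ (cst 0)) (is_derive_cst _ _ _).
    by near=> y; rewrite W0// ltW//; near: y; exact: lt_nbhsl.
  have [||||d1 d2] := @continuous_FTC1_closed R w (a - 1) x (x + 1).
  - by rewrite ltrDl.
  - exact/continuous_itv_integrable/smooth_continuous.
  - by rewrite ltrBlDr (le_lt_trans ax)// ltrDl.
  - exact: smooth_continuous.
  by rewrite -d2 derive1E; apply: derivableP.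
exists W; split => //; first exact: smooth_prim dW sw.
by apply/funext => x; rewrite derive1E derive_val.
Unshelve. all: by end_near. Qed.

(** The normalised primitive of the bump [flat 0 x * flat 0 (1 - x)]. All bumps and
cutoffs below are affine images of this step. *)
Lemma smooth_step_exists : exists (th : R -> R) (C : R),
  [/\ smooth th, forall x, x <= 0 -> th x = 0, forall x, 1 <= x -> th x = 1,
      forall x, 0 <= th x <= 1 & forall x, 0 <= derive1 th x <= C].
Proof.
pose w x : R := flat 0 x * flat 0 (- 1 * x + 1).
have sw : smooth w.
  by apply: smoothM; [exact: smooth_flat|apply: smooth_affine; exact: smooth_flat].
have w0 x : x <= 0 -> w x = 0 by move=> x0; rewrite /w flat_le0// mul0r.
have w1 x : 1 <= x -> w x = 0.
  by move=> x0; rewrite /w [flat _ (_ + _)]flat_le0 ?mulr0//; lra.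
have wge0 x : 0 <= w x by rewrite mulr_ge0// flat_ge0.
have wgt0 x : 0 < x < 1 -> 0 < w x.
  by move=> /andP[x0 x1]; rewrite mulr_gt0// flat_gt0//; lra.
have flat1 x : flat 0 x <= 1 :> R.
  rewrite /flat; case: ifPn => // x0; rewrite expr0 mul1r.
  by rewrite -expR0 ler_expR oppr_le0 invr_ge0 ltW.
have wle1 x : w x <= 1.
  by rewrite -[leRHS]mulr1 ler_pM// flat_ge0.
have [W [sW W' W0]] := smooth_primitive sw w0.
have dW x : derivable W x 1 by exact: smooth_derivable.
have cW := smooth_continuous sW.
have Wnd x y : x <= y -> W x <= W y.
  move=> xy; rewrite -subr_ge0 -smooth_FTC//; apply: Rintegral_ge0 => t _.
  by rewrite W'.
have W1 : 0 < W 1.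
  rewrite -(W0 0)//; apply: (@gtr0_derive1_lt_cc _ W 0 1) => //=.
  - by move=> x x01; rewrite W'; apply: wgt0; move: x01; rewrite in_itv.
  - exact: continuous_subspaceT.
  - by rewrite in_itv/= lexx ler01.
  - by rewrite in_itv/= lexx ler01.
have Wx1 x : 1 <= x -> W x = W 1.
  move=> x1; apply/eqP; rewrite -subr_eq0 -smooth_FTC// W'.
  by apply/eqP/Rintegral_itv0 => y /andP[y1 _]; exact: w1.
have th' x : is_derive x (1 : R) (fun y => (W 1)^-1 * W y) ((W 1)^-1 * w x).
  rewrite -W'; apply: (@is_deriveZ _ _ _ W); exact: smooth_is_derive.
exists (fun x => (W 1)^-1 * W x), (W 1)^-1; split.
- exact: smoothZ.
- by move=> x x0; rewrite (W0 x x0) mulr0.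
- by move=> x /Wx1 ->; rewrite mulVf// gt_eqF.
- move=> x; rewrite mulrC divr_ge0 ?(ltW W1)//=; last first.
    have [x0|/ltW x0] := leP x 0; first by rewrite (W0 x x0).
    by rewrite -(W0 0)// Wnd.
  rewrite ler_pdivrMr// mul1r; have [x1|/ltW x1] := leP x 1; first exact: Wnd.
  by rewrite (Wx1 x x1).
- move=> x; rewrite derive1E derive_val.
  have V0 : 0 <= (W 1)^-1 by rewrite invr_ge0 ltW.
  by have := wge0 x; have := wle1 x; nra.
Qed.

End Step.
(** * Test functions and weak derivatives *)

Section WeakDerivatives.
Variable R : realType.
Implicit Types (f g u v phi chi : R -> R) (n k : nat) (t x a b : R).
Notation mu := (@lebesgue_measure R).
Notation Rp := (@Rplus R).

Lemma RplusE : Rp = [set` `]0, +oo[].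
Proof. by apply/seteqP; split => x /=; rewrite in_itv/= andbT. Qed.

Lemma open_Rplus : open Rp.
Proof. by rewrite RplusE; exact: interval_open. Qed.

Lemma measurable_Rplus : measurable Rp.
Proof. by rewrite RplusE; exact: measurable_itv. Qed.

Lemma itv_sub_Rplus a b : 0 < a -> `[a, b] `<=` Rp.
Proof. by move=> a0 x /=; rewrite in_itv/= => /andP[/(lt_le_trans a0)]. Qed.

Lemma within_Rplus f :
  {within Rp, continuous f} <-> (forall x, 0 < x -> {for x, continuous f}).
Proof.
rewrite continuous_open_subspace; last exact: open_Rplus.
by split=> h x; [move=> x0; apply: h; rewrite inE|rewrite inE => x0; exact: h].
Qed.

(** The open interval makes [f] vanish at [a] and [b] too, so that boundary terms
disappear in integrations over [`[a, b]]. *)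
Definition supp_in a b f := forall x, ~~ (a < x < b) -> f x = 0.

Lemma test_funP phi : test_fun phi <->
  smooth phi /\ exists a b, [/\ 0 < a, a < b & supp_in a b phi].
Proof.
split=> [[sphi cphi phiR]|[/smoothP sphi [a [b [a0 ab phi0]]]]].
  split; first exact/smoothP.
  have [M [_ /(_ (`|M| + 1))MK]] := compact_bounded cphi.
  have {}MK x : phi x != 0 -> `|x| <= `|M| + 1.
    by move=> px; apply: MK; [rewrite (le_lt_trans (ler_norm M))// ltrDl|exact: subset_closure].
  have : nbhs (0 : R) (~` closure [set t | phi t != 0]).
    apply: open_nbhs_nbhs; split; last by move=> /phiR; rewrite /Rplus/= ltxx.
    by apply: closed_openC; exact: closed_closure.
  move=> /nbhs_ballP[e /= e0 be].
  have ea x : phi x != 0 -> e <= x.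
    move=> px; have x0 : 0 < x by apply: phiR; exact: subset_closure.
    rewrite leNgt; apply/negP => xe.
    have : ball (0 : R) e x by rewrite /ball/= sub0r normrN gtr0_norm.
    by move=> /be; apply; exact: subset_closure.
  exists (e / 2), (e + `|M| + 2); split.
  - by rewrite divr_gt0.
  - by have := normr_ge0 M; lra.
  - move=> x; apply: contraNeq => px; have := ea _ px; have := MK _ px.
    have := ler_norm x; have := e0; lra.
have sub : closure [set t | phi t != 0] `<=` `[a, b].
  have cl : closed `[a, b] by exact: interval_closed.
  move/closure_id : cl => ->; apply: closure_subset => x /=.
  by rewrite in_itv/=; apply: contraR => h; apply/eqP/phi0; apply: contra h => /andP[/ltW-> /ltW->].
split; first exact: sphi.
- apply: subclosed_compact sub; [exact: closed_closure|exact: segment_compact].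
- exact: subset_trans sub (itv_sub_Rplus a0).
Qed.

Lemma derive1_supp a b phi x : supp_in a b phi -> ~~ (a <= x <= b) ->
  derive1 phi x = 0.
Proof.
move=> phi0; rewrite negb_and -!ltNge derive1E.
move=> h; rewrite (@near_eq_derive _ _ _ phi (cst 0)) ?derive_cst//.
case/orP : h => h.
- near=> y; apply: phi0; rewrite negb_and -leNgt; apply/orP; left.
  by apply/ltW; near: y; exact: lt_nbhsl.
- near=> y; apply: phi0; rewrite negb_and -!leNgt; apply/orP; right.
  by apply/ltW; near: y; exact: lt_nbhsr.
Unshelve. all: by end_near. Qed.

Lemma Rintegral_supp f a b : 0 < a -> (forall x, ~~ (a <= x <= b) -> f x = 0) ->
  \int[mu]_(t in Rp) f t = \int[mu]_(t in `[a, b]) f t.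
Proof.
move=> a0 f0; rewrite Rintegral_mkcond [RHS]Rintegral_mkcond.
congr (Rintegral _ _ _); apply/funext => x; rewrite !patchE.
case: ifPn => xR; case: ifPn => xab //.
- by apply: f0; move: xab; rewrite notin_setE/= in_itv => /negP.
- move: xR; rewrite notin_setE => xR; exfalso; apply: xR.
  by move: xab; rewrite inE; exact: itv_sub_Rplus.
Qed.

Lemma continuous_bound f a b : continuous f ->
  exists M, 0 <= M /\ forall x, a <= x <= b -> `|f x| <= M.
Proof.
move=> cf; have [ab|ba] := leP a b; last first.
  by exists 0; split => // x /andP[/le_trans h /h]; rewrite leNgt ba.
have [|c _ h] := @EVT_max _ (fun x => `|f x|) a b ab.
  by apply: continuous_subspaceT => x; apply: cvg_norm; exact: cf.
by exists `|f c|; split => // x xab; apply: h; rewrite in_itv.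
Qed.

Lemma loc_integrable_itv f a b : locally_integrable Rp f -> 0 < a ->
  mu.-integrable `[a, b] (EFin \o f).
Proof.
move=> [mf _ fK] a0; apply/integrableP; split.
  apply/measurable_EFinP; apply: measurable_funS mf; first exact: measurable_Rplus.
  exact: itv_sub_Rplus.
by apply: fK; [exact: itv_sub_Rplus|exact: segment_compact].
Qed.

Lemma integrable_itvM f g a b : mu.-integrable `[a, b] (EFin \o f) ->
  continuous g -> mu.-integrable `[a, b] (EFin \o (fun x => f x * g x)).
Proof.
move=> fi cg; have [M [M0 gM]] := continuous_bound a b cg.
apply: (@integrableMl _ _ _ mu `[a, b] _ (EFin \o f) g) => //.
- by apply: measurable_funTS; exact: continuous_measurable_fun.
- exists M; split; first by rewrite ger0_real.
  move=> N MN x /=; rewrite in_itv/= => xab.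
  exact: le_trans (gM _ xab) (ltW MN).
Qed.

Lemma loc_integrable_cont f : (forall x, 0 < x -> {for x, continuous f}) ->
  locally_integrable Rp f.
Proof.
move=> cf; have cR : {within Rp, continuous f} by apply/within_Rplus.
split.
- apply: subspace_continuous_measurable_fun => //; exact: measurable_Rplus.
- exact: open_Rplus.
- move=> K KR cK; have : mu.-integrable K (EFin \o f).
    by apply: continuous_compact_integrable => //; exact: continuous_subspaceW cR.
  by case/integrableP.
Qed.

Lemma loc_integrableM f g : locally_integrable Rp f -> continuous g ->
  locally_integrable Rp (fun x => f x * g x).
Proof.
move=> [mf oR fK] cg; split => //.
  by apply: measurable_funM => //; apply: measurable_funTS; exact: continuous_measurable_fun.
move=> K KR cK; have mK := compact_measurable cK.
have : mu.-integrable K ((EFin \o f) \* (EFin \o g))%E.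
  apply: integrableMl => //.
  - apply/integrableP; split; last exact: fK.
    apply/measurable_EFinP; apply: measurable_funS mf => //.
    exact: measurable_Rplus.
  - by apply: measurable_funTS; exact: continuous_measurable_fun.
  - have : compact (g @` K).
      by apply: continuous_compact => //; exact: continuous_subspaceT.
    move=> /compact_bounded[M [Mr h]]; exists M; split => // N MN x Kx.
    by apply: (h N MN); exists x.
by case/integrableP.
Qed.

(** Restricting the integrals to a compact interval containing the support makes
every product of a locally integrable and a continuous function integrable. *)
Lemma is_weak_derivP u v : is_weak_deriv u v <-> locally_integrable Rp v /\
  forall phi a b, 0 < a -> a < b -> smooth phi -> supp_in a b phi ->
    \int[mu]_(t in `[a, b]) (u t * derive1 phi t) =
    - \int[mu]_(t in `[a, b]) (v t * phi t).
Proof.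
have aux phi a b : 0 < a -> supp_in a b phi ->
    \int[mu]_(t in Rp) (u t * derive1 phi t) =
    \int[mu]_(t in `[a, b]) (u t * derive1 phi t) /\
    \int[mu]_(t in Rp) (v t * phi t) = \int[mu]_(t in `[a, b]) (v t * phi t).
  move=> a0 phi0; split; apply: Rintegral_supp => // x xab.
  - by rewrite (derive1_supp phi0)// mulr0.
  - rewrite phi0 ?mulr0//; apply: contra xab => /andP[/ltW-> /ltW->] //.
split=> -[liv h]; split => //.
- move=> phi a b a0 ab sphi phi0; have [<- <-] := aux phi a b a0 phi0.
  by apply: h; apply/test_funP; split => //; exists a, b.
- move=> phi /test_funP[sphi [a [b [a0 ab phi0]]]].
  by have [-> ->] := aux phi a b a0 phi0; exact: h.
Qed.

Lemma smooth_weak_deriv f : smooth f -> is_weak_deriv f (derive1 f).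
Proof.
move=> sf; have cf := smooth_continuous sf.
have cdf := smooth_continuous (smooth_derive sf).
apply/is_weak_derivP; split; first by apply: loc_integrable_cont => x _; exact: cdf.
move=> phi a b a0 ab sphi phi0.
have cphi := smooth_continuous sphi.
rewrite (@Rintegration_by_parts _ f phi (derive1 f) (derive1 phi))//.
- by rewrite !phi0 ?ltxx ?andbF// !mulr0 subrr sub0r.
- exact: continuous_subspaceT.
- exact: derivable_oo_smooth.
- exact/continuous_subspaceT/smooth_continuous/smooth_derive.
- exact: derivable_oo_smooth.
Qed.

Lemma is_weak_derivB u v f g :
  locally_integrable Rp u -> locally_integrable Rp f ->
  is_weak_deriv u v -> is_weak_deriv f g -> is_weak_deriv (u \- f) (v \- g).
Proof.
move=> liu lif /is_weak_derivP[liv uv] /is_weak_derivP[lig fg].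
apply/is_weak_derivP; split; first exact: locally_integrableB.
move=> phi a b a0 ab sphi phi0.
have cphi := smooth_continuous sphi.
have cdphi := smooth_continuous (smooth_derive sphi).
under eq_Rintegral do rewrite mulrBl.
rewrite RintegralB//; [|exact/integrable_itvM/cdphi/loc_integrable_itv..].
under [in RHS]eq_Rintegral do rewrite mulrBl.
rewrite RintegralB//; [|exact/integrable_itvM/cphi/loc_integrable_itv..].
by rewrite uv// fg// opprB addrC opprK.
Qed.

(** If [phi] is a test function, so is [chi * phi]; this is the Leibniz rule tested
against [phi]. *)
Lemma is_weak_derivM u v chi :
  locally_integrable Rp u -> is_weak_deriv u v -> smooth chi ->
  is_weak_deriv (fun x => u x * chi x)
                (fun x => v x * chi x + u x * derive1 chi x).
Proof.
move=> liu /is_weak_derivP[liv uv] schi.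
have cchi := smooth_continuous schi.
have cdchi := smooth_continuous (smooth_derive schi).
apply/is_weak_derivP; split.
  by apply: locally_integrableD; exact: loc_integrableM.
move=> phi a b a0 ab sphi phi0.
have cphi := smooth_continuous sphi.
have cdphi := smooth_continuous (smooth_derive sphi).
have dE x : derive1 (fun x => chi x * phi x) x =
    chi x * derive1 phi x + phi x * derive1 chi x.
  rewrite derive1E; apply: derive_val.
  by apply: is_deriveM; exact: smooth_is_derive.
have ia w : continuous w -> mu.-integrable `[a, b] (EFin \o (fun x => u x * w x)).
  by move=> cw; exact/integrable_itvM/cw/loc_integrable_itv.
have iv w : continuous w -> mu.-integrable `[a, b] (EFin \o (fun x => v x * w x)).
  by move=> cw; exact/integrable_itvM/cw/loc_integrable_itv.
have c1 : continuous (fun x => chi x * derive1 phi x).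
  by move=> x; apply: cvgM; [exact: cchi|exact: cdphi].
have c2 : continuous (fun x => phi x * derive1 chi x).
  by move=> x; apply: cvgM; [exact: cphi|exact: cdchi].
have c3 : continuous (fun x => chi x * phi x).
  by move=> x; apply: cvgM; [exact: cchi|exact: cphi].
have H : \int[mu]_(t in `[a, b]) (u t * (chi t * derive1 phi t)) +
    \int[mu]_(t in `[a, b]) (u t * (phi t * derive1 chi t)) =
    - \int[mu]_(t in `[a, b]) (v t * (chi t * phi t)).
  rewrite -uv//; [|exact: smoothM|by move=> x /phi0 ->; rewrite mulr0].
  rewrite -RintegralD//; [|exact: ia..].
  by apply: eq_Rintegral => x _; rewrite dE mulrDr.
under eq_Rintegral do rewrite -mulrA.
move/eqP: H; rewrite eq_sym -subr_eq => /eqP <-; rewrite -opprD -RintegralD//; [|exact: iv|exact: ia].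
by congr (- _); apply: eq_Rintegral => x _; ring.
Qed.

End WeakDerivatives.
(** * Fundamental theorem of calculus for weak derivatives *)

Section DuBoisReymond.
Variable R : realType.
Implicit Types (f g u v phi chi : R -> R) (n k : nat) (t x a b : R).
Notation mu := (@lebesgue_measure R).
Notation Rp := (@Rplus R).

Lemma Rdominated_cvg (D : set R) (f_ : nat -> R -> R) f g : measurable D ->
  (forall n, measurable_fun D (f_ n)) ->
  (forall x, D x -> f_ ^~ x @ \oo --> f x) ->
  mu.-integrable D (EFin \o g) ->
  (forall n x, D x -> `|f_ n x| <= g x) ->
  \int[mu]_(x in D) f_ n x @[n --> \oo] --> \int[mu]_(x in D) f x.
Proof.
move=> mD mf_ ff ig fg.
have ef n x : D x -> (`|(f_ n x)%:E| <= (g x)%:E)%E.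
  by move=> Dx; rewrite lee_fin fg.
have mE n : measurable_fun D (EFin \o f_ n) by apply/measurable_EFinP.
have cE x : D x -> (f_ n x)%:E @[n --> \oo] --> (f x)%:E.
  by move=> Dx; apply: cvg_EFin; [exact: nearW|exact: ff].
have mf : measurable_fun D (EFin \o f) by exact: (emeasurable_fun_cvg _ _ mE cE).
have [||fin _ +] := @dominated_convergence _ _ _ mu D mD
  (fun n => EFin \o f_ n) (EFin \o f) (EFin \o g) mE mf _ ig.
- exact: aeW.
- by apply: aeW => x n; exact: ef.
rewrite -[X in _ --> X -> _]fineK; first exact: fine_cvg.
exact: integrable_fin_num fin.
Qed.

Lemma step_derive0 (th : R -> R) x :
  (forall x, x <= 0 -> th x = 0) -> (forall x, 1 <= x -> th x = 1) ->
  ~~ (0 <= x <= 1) -> derive1 th x = 0.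
Proof.
move=> th0 th1; rewrite negb_and -!ltNge derive1E => /orP[x0|x1].
- rewrite (@near_eq_derive _ _ _ th (cst 0)) ?derive_cst//.
  by near=> y; apply: th0; apply/ltW; near: y; exact: lt_nbhsl.
- rewrite (@near_eq_derive _ _ _ th (cst 1)) ?derive_cst//.
  by near=> y; apply: th1; apply/ltW; near: y; exact: lt_nbhsr.
Unshelve. all: by end_near. Qed.

(** The derivatives of the steepening steps are nonnegative, have mass [1] and are
supported in [`[s, s + 1 / n.+1]]: they are an approximate identity at [s]. *)
Lemma step_derivative_cvg u (th : R -> R) (s a b : R) :
  smooth th -> (forall x, x <= 0 -> th x = 0) -> (forall x, 1 <= x -> th x = 1) ->
  (forall x, 0 <= derive1 th x) ->
  mu.-integrable `[a, b] (EFin \o u) -> {for s, continuous u} ->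
  a <= s -> s < b ->
  \int[mu]_(t in `[a, b]) (u t * (n.+1%:R * derive1 th (n.+1%:R * t + - n.+1%:R * s)))
    @[n --> \oo] --> u s.
Proof.
move=> sth th0 th1 dth iu cu as_ sb; have ab : a <= b by lra.
apply/cvgrPdist_le => /= e e0.
have [d /= d0 du] : exists2 d, 0 < d & forall x, `|s - x| < d -> `|u s - u x| <= e.
  have /cvgrPdist_le/(_ e e0) := cu.
  by move=> /nbhs_ballP[d /= d0 hd]; exists d => // x sx; apply: hd.
near=> n.
have [cd cbs] : d^-1 < n.+1%:R :> R /\ (b - s)^-1 < n.+1%:R :> R.
  split; near: n.
  - have := nbhs_infty_gtr d^-1; apply: filterS => n /lt_le_trans; apply.
    by rewrite ler_nat.
  - have := nbhs_infty_gtr (b - s)^-1; apply: filterS => n /lt_le_trans; apply.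
    by rewrite ler_nat.
set c : R := n.+1%:R in cd cbs *.
have c0 : 0 < c by rewrite ltr0n.
pose w t := c * derive1 th (c * t + - c * s).
pose T t := th (c * t + - c * s).
have sT : smooth T by exact: smooth_affine.
have dT : derive1 T = w.
  apply/funext => t; rewrite derive1E; apply: derive_val.
  by apply: is_derive_affine; exact: smooth_is_derive.
have cw : continuous w by rewrite -dT; exact/smooth_continuous/smooth_derive.
have iw : mu.-integrable `[a, b] (EFin \o w) by exact: continuous_itv_integrable.
have iuw := integrable_itvM iu cw.
have cuw : 1 < c * (b - s) by rewrite -ltr_pdivrMr ?subr_gt0// mul1r.
have Iw : \int[mu]_(t in `[a, b]) w t = 1.
  rewrite -dT smooth_FTC// /T th1; last by nra.
  by rewrite th0 ?subr0//; nra.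
have -> : u s = \int[mu]_(t in `[a, b]) (u s * w t).
  by rewrite RintegralZl// Iw mulr1.
have iusw : mu.-integrable `[a, b] (EFin \o (fun t => u s * w t)).
  by apply: continuous_itv_integrable => x; apply: cvgM; [exact: cvg_cst|exact: cw].
rewrite -RintegralB//.
apply: (le_trans (le_normr_Rintegral _ _)) => //=.
  exact: (integrableB (mu := mu) (measurable_itv `[a, b]) iusw iuw).
have -> : e = \int[mu]_(t in `[a, b]) (e * w t) by rewrite RintegralZl// Iw mulr1.
apply: le_Rintegral => //.
- apply/integrable_norm.
  exact: (integrableB (mu := mu) (measurable_itv `[a, b]) iusw iuw).
- by apply: continuous_itv_integrable => x; apply: cvgM; [exact: cvg_cst|exact: cw].
- move=> x _; rewrite -mulrBl normrM [ `|w x|]ger0_norm; last first.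
    by rewrite mulr_ge0// ltW.
  have [x01|x01] := boolP (0 <= c * x + - c * s <= 1); last first.
    by rewrite /w (step_derive0 th0 th1 x01) !mulr0.
  apply: ler_wpM2r; first by rewrite mulr_ge0// ltW.
  apply: du; have cd1 : 1 < c * d by rewrite -ltr_pdivrMr// mul1r.
  by rewrite distrC ger0_norm; nra.
Unshelve. all: by end_near. Qed.

Lemma step_cvg (th : R -> R) (s x : R) :
  (forall x, x <= 0 -> th x = 0) -> (forall x, 1 <= x -> th x = 1) ->
  th (n.+1%:R * x + - n.+1%:R * s) @[n --> \oo] --> ((s < x)%R%:R : R).
Proof.
move=> th0 th1; have [sx|xs] := ltP s x.
  apply: cvg_near_cst; near=> n; apply: th1.
  have : (x - s)^-1 < n.+1%:R.
    near: n; have := nbhs_infty_gtr (x - s)^-1; apply: filterS => n /lt_le_trans; apply.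
    by rewrite ler_nat.
  rewrite -[X in X < _]mul1r ltr_pdivrMr ?subr_gt0//.
  have := ltr0n R n.+1; move: (n.+1%:R : R) => c.
  by nra.
apply: cvg_near_cst; apply: nearW => n; apply: th0.
have : 0 < n.+1%:R :> R by rewrite ltr0n.
by move: (n.+1%:R : R) => c; nra.
Unshelve. all: by end_near. Qed.

(** Test with the difference of two steps of width [1 / n.+1] starting at [s] and
[t]. By [step_derivative_cvg] the left-hand side of the weak formula tends to
[u s - u t], while the test functions tend pointwise to the indicator of
[`]s, t]]. *)
Lemma weak_deriv_FTC u v s t : (forall x, 0 < x -> {for x, continuous u}) ->
  is_weak_deriv u v -> 0 < s -> s < t ->
  u t - u s = \int[mu]_(x in `[s, t]) v x.
Proof.
move=> cu /is_weak_derivP[liv uv] s0 st.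
have [th [C [sth th0 th1 th01 dth]]] := smooth_step_exists R.
have dth0 x : 0 <= derive1 th x by have /andP[] := dth x.
pose a := s / 2; pose b := t + 1.
have t0 : 0 < t by lra.
have [a0 as_ tb] : [/\ 0 < a, a < s & t < b] by rewrite /a /b; split; lra.
have sb : s < b by lra.
have liu := loc_integrable_cont cu.
have iu := loc_integrable_itv b liu a0.
have iv := loc_integrable_itv b liv a0.
pose c n : R := n.+1%:R.
pose T n r x := th (c n * x + - c n * r).
have sT n r : smooth (T n r) by exact: smooth_affine.
have dT n r x : derive1 (T n r) x = c n * derive1 th (c n * x + - c n * r).
  rewrite derive1E; apply: derive_val.
  by apply: is_derive_affine; exact: smooth_is_derive.
pose phi n x := T n s x - T n t x.
have sphi n : smooth (phi n) by exact: smoothB.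
have cphi n : continuous (phi n) by exact: smooth_continuous.
have dphi n x : derive1 (phi n) x = derive1 (T n s) x - derive1 (T n t) x.
  by rewrite [LHS]derive1E; apply: derive_val; apply: is_deriveB; exact: smooth_is_derive.
have c1 n : 1 <= c n by rewrite /c ler1n.
have phi0 n : supp_in a b (phi n).
  move=> x; rewrite negb_and -!leNgt => xab; rewrite /phi /T; have := c1 n.
  case/orP : xab => xab cn1; first by rewrite !th0 ?subrr//; nra.
  by rewrite !th1 ?subrr//; rewrite /b in xab; nra.
have E n := uv _ _ _ a0 (lt_trans as_ sb) (sphi n) (phi0 n).
have iuT n r : mu.-integrable `[a, b] (EFin \o (fun x => u x * derive1 (T n r) x)).
  by apply: integrable_itvM => //; apply/smooth_continuous/smooth_derive.
have L : \int[mu]_(x in `[a, b]) (u x * derive1 (phi n) x) @[n --> \oo]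
    --> u s - u t.
  have -> : (fun n => \int[mu]_(x in `[a, b]) (u x * derive1 (phi n) x)) =
      (fun n => \int[mu]_(x in `[a, b]) (u x * derive1 (T n s) x) -
                \int[mu]_(x in `[a, b]) (u x * derive1 (T n t) x)).
    apply/funext => n; rewrite -RintegralB//.
    by apply: eq_Rintegral => x _; rewrite dphi mulrBr.
  apply: cvgB.
  - under eq_fun => n do under eq_Rintegral do rewrite dT.
    by apply: step_derivative_cvg => //; [exact: cu|exact: ltW].
  - under eq_fun => n do under eq_Rintegral do rewrite dT.
    by apply: step_derivative_cvg => //; [exact: cu|lra].
have M : \int[mu]_(x in `[a, b]) (v x * phi n x) @[n --> \oo]
    --> \int[mu]_(x in `[a, b]) (v x * ((s < x)%R%:R - (t < x)%R%:R)).
  apply: (@Rdominated_cvg _ _ _ (fun x => `|v x|)) => //.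
  - move=> n; apply/measurable_EFinP.
    exact: measurable_int (integrable_itvM iv (cphi n)).
  - move=> x _; apply: cvgM; first exact: cvg_cst.
    by apply: cvgB; exact: step_cvg.
  - exact: integrable_norm.
  - move=> n x _; rewrite normrM -[leRHS]mulr1; apply: ler_wpM2l => //.
    rewrite ler_norml /phi /T.
    by have := th01 (c n * x + - c n * s); have := th01 (c n * x + - c n * t); lra.
have L' : \int[mu]_(x in `[a, b]) (u x * derive1 (phi n) x) @[n --> \oo]
    --> - \int[mu]_(x in `[a, b]) (v x * ((s < x)%R%:R - (t < x)%R%:R)).
  under eq_fun do rewrite E.
  exact: cvgN M.
have H := cvg_unique (@Rhausdorff R) L L'.
have -> : u t - u s = - (u s - u t) by rewrite opprB.
rewrite H opprK.
rewrite -[RHS]Rintegral_itv_obnd_cbnd; last first.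
  by apply: (integrableS _ _ _ iv) => //; apply: subset_itv; rewrite bnd_simp ltW.
rewrite Rintegral_mkcond [RHS]Rintegral_mkcond; congr (Rintegral _ _ _).
apply/funext => x; rewrite !patchE !mem_setE !in_itv/=.
have [sx|xs] := ltP s x => /=; last first.
  by rewrite ltNge (le_trans xs (ltW st))/= subrr mulr0; case: ifP.
have [tx|xt] := ltP t x => /=; first by rewrite subrr mulr0; case: ifP.
by rewrite subr0 mulr1 (le_trans (ltW as_) (ltW sx))/= (le_trans xt (ltW tb)).
Qed.

End DuBoisReymond.
(** * Uniqueness of the weak derivative, and weighted energies *)

Section Energy.
Variable R : realType.
Implicit Types (f g u v phi chi : R -> R) (n k : nat) (t x a b p beta : R).
Notation mu := (@lebesgue_measure R).
Notation Rp := (@Rplus R).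

(** By [weak_deriv_FTC] the difference of two weak derivatives has zero integral
over every compact interval, so it vanishes at each of its Lebesgue points. The
intervals [`[n.+1^-1, n.+1]] exhaust the half-line. *)
Lemma weak_deriv_ae u v1 v2 : (forall x, 0 < x -> {for x, continuous u}) ->
  is_weak_deriv u v1 -> is_weak_deriv u v2 ->
  {ae mu, forall x, Rp x -> v1 x = v2 x}.
Proof.
move=> cu uv1 uv2.
have li1 : locally_integrable Rp v1 by case: uv1.
have li2 : locally_integrable Rp v2 by case: uv2.
pose d x := v1 x - v2 x.
pose c n : R := n.+1%:R^-1; pose C n : R := n.+1%:R.
have c0 n : 0 < c n by rewrite invr_gt0.
have id n : mu.-integrable `[c n, C n] (EFin \o d).
  by apply: loc_integrable_itv => //; exact: locally_integrableB.
have nu n : {ae mu, forall x, c n < x < C n -> d x = 0}.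
  pose dn := d \_ `[c n, C n].
  have := lebesgue_differentiation
    (integrable_locally_restrict (measurable_itv `[c n, C n]) (id n)).
  apply: filterS; first exact: (ae_filter_ringOfSetsType mu).
  move=> x xpt /andP[cx xC].
  have idn : mu.-integrable `[c n, C n] (EFin \o dn).
    by rewrite -restrict_EFin; apply/integrable_restrict => //; rewrite setIid.
  have [||_] := FTC1_lebesgue_pt xC idn => //.
  rewrite /dn patchE mem_set/= ?in_itv/= ?(ltW cx) ?(ltW xC)// => <-.
  rewrite derive1E (@near_eq_derive _ _ _ _ (cst 0)) ?derive_cst//.
  near=> y.
  have cy : c n < y by near: y; exact: lt_nbhsr.
  have yC : y < C n by near: y; exact: lt_nbhsl.
  rewrite [RHS]/=.
  transitivity (\int[mu]_(t in `[c n, y]) (v1 t - v2 t)).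
    apply: eq_Rintegral => t; rewrite inE/= in_itv/= => /andP[ct ty].
    by rewrite patchE mem_set//= in_itv/= ct (le_trans ty (ltW yC)).
  rewrite RintegralB//; [|exact: loc_integrable_itv..].
  by rewrite -(weak_deriv_FTC cu uv1)// -(weak_deriv_FTC cu uv2)// subrr.
apply: (@filterS _ _ (ae_filter_ringOfSetsType mu) _ _ _ (ae_foralln nu)).
move=> x dx0 /= x0.
have [n /andP[n1 n2]] : exists n, c n < x < C n.
  have [n _ nP] : \forall n \near \oo, Num.max x x^-1 < n%:R.
    exact: nbhs_infty_gtr.
  exists n; have := nP n (leqnn n); rewrite gt_max => /andP[xn xVn].
  have nS : n%:R < n.+1%:R :> R by rewrite ltr_nat.
  rewrite /c /C (lt_trans xn nS) andbT -[ltRHS]invrK ltf_pV2 ?posrE//.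
  - exact: lt_trans xVn nS.
  - by rewrite invr_gt0.
by apply/eqP; rewrite -subr_eq0; apply/eqP/(dx0 n); rewrite n1.
Unshelve. all: by end_near. Qed.

Lemma weak_deriv_FTC_le u v s t : (forall x, 0 < x -> {for x, continuous u}) ->
  is_weak_deriv u v -> 0 < s -> s <= t ->
  (`|u t - u s|%:E <= \int[mu]_(x in `[s, t]) `|v x|%:E)%E.
Proof.
move=> cu uv s0; rewrite le_eqVlt => /predU1P[<-|st].
  by rewrite subrr normr0 integral_ge0.
rewrite (weak_deriv_FTC cu uv)//.
have iv : mu.-integrable `[s, t] (EFin \o v) by apply: loc_integrable_itv => //; case: uv.
rewrite EFin_normr_Rintegral//.
exact: (le_abse_integral mu (measurable_itv `[s, t]) (measurable_int mu iv)).
Qed.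

Definition wpow p beta f t : R := `|f t| `^ p * t `^ beta.

(** The [p]-th power of [wLp_norm]. *)
Definition energy p beta f : \bar R :=
  (\int[mu]_(t in Rp) (wpow p beta f t)%:E)%E.

Lemma wpow_ge0 p beta f t : 0 <= wpow p beta f t.
Proof. by rewrite mulr_ge0 ?powR_ge0. Qed.

Lemma energy_ge0 p beta f : (0 <= energy p beta f)%E.
Proof. by apply: integral_ge0 => x _; rewrite lee_fin wpow_ge0. Qed.

Lemma measurable_wpow p beta f (D : set R) : measurable_fun D f ->
  measurable_fun D (EFin \o wpow p beta f).
Proof.
move=> mf; apply/measurable_EFinP; apply: measurable_funM.
- apply: (@measurableT_comp _ _ _ _ _ _ (fun x : R => x `^ p)) => //.
  exact: measurableT_comp.
- exact: measurable_funTS.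
Qed.

Lemma energy_ae p beta f g : measurable_fun Rp f -> measurable_fun Rp g ->
  {ae mu, forall x, Rp x -> f x = g x} -> energy p beta f = energy p beta g.
Proof.
move=> mf mg fg; apply: ge0_ae_eq_integral.
- exact: measurable_Rplus.
- exact: measurable_wpow.
- exact: measurable_wpow.
- by move=> x _; rewrite lee_fin wpow_ge0.
- by move=> x _; rewrite lee_fin wpow_ge0.
- move: fg; apply: filterS; first exact: (ae_filter_ringOfSetsType mu).
  by move=> x /= h /h; rewrite /wpow => ->.
Qed.

Lemma weak_deriv_spec u v : is_weak_deriv u v -> is_weak_deriv u (weak_deriv u).
Proof. by move=> uv; exact: (@xgetI _ (fun=> 0) [set v | is_weak_deriv u v] v). Qed.

(** Allows any weak derivative in place of the one chosen by [weak_deriv]. *)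
Lemma energy_weak_deriv p beta u v : (forall x, 0 < x -> {for x, continuous u}) ->
  is_weak_deriv u v -> energy p beta (weak_deriv u) = energy p beta v.
Proof.
move=> cu uv; have uw := weak_deriv_spec uv.
apply: energy_ae; [by case: uw => -[]|by case: uv => -[]|].
exact: weak_deriv_ae uw uv.
Qed.

Lemma wLp_norm_lt p beta f (e : R) : 0 < p -> 0 < e ->
  (energy p beta f < (e `^ p)%:E)%E -> (wLp_norm p beta f < e%:E)%E.
Proof.
move=> p0 e0; rewrite /wLp_norm -/(energy p beta f).
have := energy_ge0 p beta f; case: (energy p beta f) => [r| |]//=.
rewrite !lee_fin !lte_fin => r0 rep.
have pn0 : p != 0 by rewrite gt_eqF.
have -> : e = (e `^ p) `^ p^-1 by rewrite -powRrM mulfV// powRr1// ltW.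
by apply: gt0_ltr_powR; rewrite ?invr_gt0// nnegrE// powR_ge0.
Qed.

Lemma energy_lt p beta f (e : R) : 0 < p -> 0 < e ->
  (wLp_norm p beta f < e%:E)%E -> (energy p beta f < (e `^ p)%:E)%E.
Proof.
move=> p0 e0; rewrite /wLp_norm -/(energy p beta f).
have pn0 : p != 0 by rewrite gt_eqF.
have := energy_ge0 p beta f; case: (energy p beta f) => [r| |]//=.
  rewrite !lee_fin !lte_fin => r0 rep.
  have -> : r = (r `^ p^-1) `^ p by rewrite -powRrM mulVf// powRr1.
  by apply: gt0_ltr_powR; rewrite // nnegrE ?powR_ge0// ltW.
by rewrite gt_eqF ?invr_gt0.
Qed.

Lemma wLp_norm_fin p beta f : 0 < p ->
  (wLp_norm p beta f < +oo)%E <-> (energy p beta f < +oo)%E.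
Proof.
move=> p0; rewrite /wLp_norm -/(energy p beta f); split.
  by apply: lty_poweRy; rewrite gt_eqF ?invr_gt0.
exact: poweR_lty.
Qed.

(** From [`|x + y| <= 2 * max `|x| `|y|]. *)
Lemma wpowD p beta f g t : 0 < p ->
  wpow p beta (f \+ g) t <= 2 `^ p * (wpow p beta f t + wpow p beta g t).
Proof.
move=> p0; rewrite /wpow -mulrDl mulrA; apply: ler_wpM2r; first exact: powR_ge0.
have key x y : 0 <= x -> x <= y -> (x + y) `^ p <= 2 `^ p * (x `^ p + y `^ p).
  move=> x0 xy; have y0 := le_trans x0 xy.
  apply: (@le_trans _ _ ((2 * y) `^ p)).
    by apply: ge0_ler_powR; rewrite ?nnegrE ?addr_ge0 ?mulr_ge0 ?(ltW p0)//; lra.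
  by rewrite powRM// ler_wpM2l ?powR_ge0// lerDr powR_ge0.
apply: (@le_trans _ _ ((`|f t| + `|g t|) `^ p)).
  by apply: ge0_ler_powR; rewrite ?nnegrE ?addr_ge0 ?(ltW p0)// ler_normD.
have [fg|/ltW gf] := leP `|f t| `|g t|; first exact: key.
by rewrite addrC [X in _ * X]addrC; exact: key.
Qed.

Lemma energyD p beta f g : 0 < p -> measurable_fun Rp f -> measurable_fun Rp g ->
  (energy p beta (f \+ g)%R <=
   (2 `^ p)%:E * (energy p beta f + energy p beta g))%E.
Proof.
move=> p0 mf mg; have mR := @measurable_Rplus R.
have mF := measurable_wpow p beta mf; have mG := measurable_wpow p beta mg.
rewrite /energy -ge0_integralD//; last 2 first.
- by move=> x _; rewrite lee_fin wpow_ge0.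
- by move=> x _; rewrite lee_fin wpow_ge0.
rewrite -ge0_integralZl_EFin//; last 2 first.
- by move=> x _; rewrite -EFinD lee_fin addr_ge0 ?wpow_ge0.
- exact: emeasurable_funD.
apply: ge0_le_integral => //.
- by move=> x _; rewrite lee_fin wpow_ge0.
- by apply: measurable_wpow; exact: measurable_funD.
- by apply: measurable_funeM; exact: emeasurable_funD.
- by move=> x _; rewrite -EFinD -EFinM lee_fin; exact: wpowD.
Qed.

End Energy.
(** * Growth estimates from the energy of the derivative *)

Section Young.
Variable R : realType.
Implicit Types (f g h u v phi chi : R -> R) (n k : nat) (t x a b p beta : R).
Notation mu := (@lebesgue_measure R).
Notation Rp := (@Rplus R).

(** Put [m = d * t `^ (- beta / (p - 1))]. If [`|x| <= m] the first summand
suffices; otherwise [`|x| = `|x| `^ (1 - p) * `|x| `^ p <= m `^ (1 - p) * `|x| `^ p],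
which is the second summand. *)
Lemma powR_young p beta x t (d : R) : 1 < p -> 0 < t -> 0 < d ->
  `|x| <= d * t `^ (- beta / (p - 1)) + d `^ (1 - p) * (`|x| `^ p * t `^ beta).
Proof.
move=> p1 t0 d0; set m := d * t `^ _; set y := `|x|.
have m0 : 0 < m by rewrite mulr_gt0// powR_gt0.
have [xm|mx] := leP y m.
  by rewrite (le_trans xm)// lerDl !mulr_ge0// powR_ge0.
have y0 : 0 < y by exact: lt_trans mx.
apply: (@le_trans _ _ (d `^ (1 - p) * (y `^ p * t `^ beta))); last first.
  by rewrite lerDr ltW.
have -> : d `^ (1 - p) * (y `^ p * t `^ beta) = m `^ (1 - p) * y `^ p.
  rewrite /m powRM ?powR_ge0 ?(ltW d0)// -powRrM.
  have -> : - beta / (p - 1) * (1 - p) = beta by field; rewrite subr_eq0 gt_eqF.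
  by rewrite [_ `^ p * _]mulrC mulrA.
have yE : y = y `^ (1 - p) * y `^ p.
  rewrite -powRD; last by rewrite (gt_eqF y0) implybT.
  by rewrite subrK powRr1// ltW.
rewrite [leLHS]yE; apply: ler_wpM2r; first exact: powR_ge0.
rewrite -(opprB p 1) !powRN lef_pV2 ?posrE ?powR_gt0//.
apply: ge0_ler_powR; rewrite ?nnegrE ?subr_ge0; exact: ltW.
Qed.

Lemma integral_powR_le a b (c : R) : 0 < a -> a <= b -> -1 < c ->
  (\int[mu]_(t in `[a, b]) (t `^ c)%:E <= (b `^ (c + 1) / (c + 1))%:E)%E.
Proof.
move=> a0; have c1 : -1 < c -> 0 < c + 1 by lra.
rewrite le_eqVlt => /predU1P[<-|ab] cN1.
  rewrite set_itv1 integral_set1 lee_fin divr_ge0 ?powR_ge0// ltW//; lra.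
have {}c1 := c1 cN1.
pose F t : R := (c + 1)^-1 * t `^ (c + 1).
have b0 : 0 < b by exact: lt_trans ab.
have dF t : 0 < t -> is_derive t (1 : R) F (t `^ c).
  move=> t0; have t0' : t \in `]0, +oo[ by rewrite in_itv/= t0.
  have dp : is_derive t (1 : R) (fun x : R => x `^ (c + 1)) ((c + 1) * t `^ c).
    have := derivableP (@derivable_powR _ 1 (c + 1) _ t0').
    by rewrite -derive1E powR_derive1// addrK.
  apply: (is_derive_eq (is_deriveZ (c + 1)^-1 dp)).
  by rewrite /GRing.scale/= mulrA mulVf ?mul1r// gt_eqF.
have cF t : 0 < t -> {for t, continuous F}.
  move=> t0; apply/differentiable_continuous/derivable1_diffP.
  by have [] := dF _ t0.
rewrite (@continuous_FTC2 _ _ F a b)//.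
- rewrite -EFinB lee_fin /F [leRHS]mulrC lerBlDr lerDl mulr_ge0 ?powR_ge0//.
  by rewrite invr_ge0 ltW.
- apply: continuous_in_subspaceT => t; rewrite inE/= in_itv/= => /andP[ta _].
  have t0 : 0 < t by exact: lt_le_trans ta.
  have t0' : t \in `]0, +oo[ by rewrite in_itv/= t0.
  apply/differentiable_continuous/derivable1_diffP.
  exact: derivable_powR.
- split.
  + by move=> t /[!in_itv]/= /andP[ta _]; have [] := dF _ (lt_trans a0 ta).
  + by apply: cvg_at_right_filter; exact: cF.
  + by apply: cvg_at_left_filter; exact: cF.
- move=> t /[!in_itv]/= /andP[ta _]; rewrite derive1E; apply: derive_val.
  exact: dF (lt_trans a0 ta).
Qed.

(** One more than the exponent in [powR_young]; its positivity is the integrability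
of that power near [0]. *)
Definition qexp p beta : R := - beta / (p - 1) + 1.

Lemma qexp_gt0 p beta : 1 < p -> beta < p - 1 -> 0 < qexp p beta.
Proof.
move=> p1 bp; rewrite /qexp.
have : -1 < - beta / (p - 1) by rewrite ltr_pdivlMr ?subr_gt0//; lra.
by lra.
Qed.

(** The right-hand side does not degenerate as [a] tends to [0]. *)
Lemma young_integral p beta h a b (d : R) : 1 < p -> beta < p - 1 ->
  0 < a -> a <= b -> 0 < d -> measurable_fun Rp h ->
  (\int[mu]_(t in `[a, b]) `|h t|%:E <= (d * (b `^ qexp p beta / qexp p beta))%:E +
    (d `^ (1 - p))%:E * \int[mu]_(t in `[a, b]) (wpow p beta h t)%:E)%E.
Proof.
move=> p1 bp a0 ab d0 mh; set q := qexp p beta; set c := - beta / (p - 1).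
have c1 : -1 < c by rewrite /c ltr_pdivlMr ?subr_gt0//; lra.
have sub := itv_sub_Rplus (b := b) a0.
have mhab : measurable_fun `[a, b] h.
  by apply: measurable_funS mh => //; exact: measurable_Rplus.
have mw := measurable_wpow p beta mhab.
have mc : measurable_fun `[a, b] (fun t : R => (t `^ c)%:E).
  by apply/measurable_EFinP; exact: measurable_funTS.
apply: (@le_trans _ _ (\int[mu]_(t in `[a, b]) (d%:E * (t `^ c)%:E +
    (d `^ (1 - p))%:E * (wpow p beta h t)%:E))%E).
  apply: ge0_le_integral => //.
  - by do 2 apply: measurableT_comp => //.
  - by apply: emeasurable_funD; exact: measurable_funeM.
  - move=> t tab; rewrite -!EFinM -EFinD lee_fin; apply: powR_young => //.
    exact: sub.
rewrite ge0_integralD//; last 4 first.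
- by move=> t _; rewrite -EFinM lee_fin mulr_ge0 ?powR_ge0// ltW.
- exact: measurable_funeM.
- by move=> t _; rewrite -EFinM lee_fin mulr_ge0 ?powR_ge0// wpow_ge0.
- exact: measurable_funeM.
rewrite ge0_integralZl_EFin//; last 2 first.
- by move=> t _; rewrite lee_fin powR_ge0.
- exact: ltW.
rewrite ge0_integralZl_EFin//; last 2 first.
- by move=> t _; rewrite lee_fin wpow_ge0.
- exact: powR_ge0.
apply: leeD => //; rewrite EFinM; apply: lee_wpmul2l; first by rewrite lee_fin ltW.
exact: integral_powR_le.
Qed.

Lemma wpow_itv_le p beta h a b : 0 < a -> measurable_fun Rp h ->
  (\int[mu]_(t in `[a, b]) (wpow p beta h t)%:E <= energy p beta h)%E.
Proof.
move=> a0 mh; apply: ge0_subset_integral => //.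
- exact: measurable_Rplus.
- exact: measurable_wpow.
- by move=> x _; rewrite lee_fin wpow_ge0.
- exact: itv_sub_Rplus.
Qed.

(** The average of [f] over [`[t, t + 1]] is controlled by the energy of [f], and the
oscillation of [f] there by the energy of its derivative; the bound is uniform in
[t] down to [0]. *)
Lemma sup_bound p beta f g t (d : R) : 1 < p -> beta < p - 1 ->
  (forall x, 0 < x -> {for x, continuous f}) -> is_weak_deriv f g ->
  0 < t -> t <= 1 -> 0 < d ->
  (`|f t|%:E <= (2 * (d * (2 `^ qexp p beta / qexp p beta)))%:E +
    (d `^ (1 - p))%:E * (energy p beta f + energy p beta g))%E.
Proof.
move=> p1 bp cf fg t0 t1 d0; set q := qexp p beta.
have q0 : 0 < q by exact: qexp_gt0.
have lif := loc_integrable_cont cf.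
have lig : locally_integrable Rp g by case: fg.
have mf : measurable_fun Rp f by case: lif.
have mg : measurable_fun Rp g by case: lig.
have tt : t <= t + 1 by rewrite lerDl.
have mI (h : R -> R) : measurable_fun Rp h -> measurable_fun `[t, t + 1] (fun x => `|h x|%:E).
  move=> mh; do 2 apply: measurableT_comp => //.
  by apply: measurable_funS mh; [exact: measurable_Rplus|exact: itv_sub_Rplus].
have Y (h : R -> R) : measurable_fun Rp h -> (\int[mu]_(x in `[t, (t + 1)%R]) `|h x|%:E <=
    (d * (2 `^ q / q))%:E + (d `^ (1 - p))%:E * energy p beta h)%E.
  move=> mh; apply: (le_trans (young_integral p1 bp t0 tt d0 mh)).
  apply: leeD.
    rewrite lee_fin ler_wpM2l ?(ltW d0)// ler_wpM2r ?invr_ge0 ?(ltW q0)//.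
    by apply: ge0_ler_powR; rewrite ?nnegrE ?(ltW q0)//; lra.
  by apply: lee_wpmul2l; [rewrite lee_fin powR_ge0|exact: wpow_itv_le].
set G := (\int[mu]_(x in `[t, (t + 1)%R]) `|g x|%:E)%E.
have G0 : (0 <= G)%E by exact: integral_ge0.
apply: (@le_trans _ _ (\int[mu]_(x in `[t, (t + 1)%R]) `|f x|%:E + G)%E); last first.
  rewrite mulr_natl mulr2n EFinD ge0_muleDr ?energy_ge0// [leRHS]addeACA.
  by apply: leeD; apply: Y.
have mu1 : mu `[t, (t + 1)%R] = 1%E.
  by rewrite lebesgue_measure_itv/= lte_fin ltrDl ltr01 -EFinB addrAC subrr add0r.
have -> : (`|f t|%:E = \int[mu]_(x in `[t, (t + 1)%R]) (cst `|f t|%:E x))%E.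
  by rewrite integral_cst//= mu1 mule1.
have -> : (G = \int[mu]_(x in `[t, (t + 1)%R]) (cst G x))%E.
  by rewrite integral_cst//= mu1 mule1.
rewrite -ge0_integralD//; last exact: mI.
apply: ge0_le_integral => //.
- by move=> x _; rewrite lee_fin.
- by apply: emeasurable_funD => //; exact: mI.
move=> x /=; rewrite in_itv/= => /andP[tx xt].
have := weak_deriv_FTC_le cf fg t0 tx.
have xG : (\int[mu]_(x0 in `[t, x]) `|g x0|%:E <= G)%E.
  apply: ge0_subset_integral => //; first exact: mI.
  by apply: subset_itvl; rewrite bnd_simp.
move=> /le_trans/(_ xG) h.
apply: (@le_trans _ _ (`|f x|%:E + `|f x - f t|%:E)%E); last first.
  by rewrite leeD2l.
by rewrite -EFinD lee_fin; have := ler_normB (f x) (f x - f t); rewrite opprB addrC subrK.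
Qed.

(** A priori weaker than convergence to [0] at [0]; for functions whose weak
derivative has finite energy the two agree, by [hardy_bound]. *)
Definition small_near0 u := forall e d : R, 0 < e -> 0 < d ->
  exists2 r, 0 < r < d & `|u r| < e.

(** Apply [young_integral] on [`[r, t]] with [d = l * t `^ (- qexp p beta / p)], the
choice for which both terms scale like [t `^ ((p - 1 - beta) / p)], and let [r]
tend to [0] along points where [u r] is small. *)
Lemma hardy_bound p beta u v t (l : R) : 1 < p -> beta < p - 1 ->
  (forall x, 0 < x -> {for x, continuous u}) -> is_weak_deriv u v ->
  small_near0 u -> 0 < t -> 0 < l ->
  (`|u t|%:E <= (t `^ ((p - 1 - beta) / p))%:E * ((l / qexp p beta)%:E +
    (l `^ (1 - p))%:E * \int[mu]_(x in `]0%R, t]) (wpow p beta v x)%:E))%E.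
Proof.
move=> p1 bp cu uv u0 t0 l0; set k := (p - 1 - beta) / p; set q := qexp p beta.
have p0 : 0 < p by lra.
have q0 : 0 < q by exact: qexp_gt0.
have mv : measurable_fun Rp v by case: uv => -[].
set A := (\int[mu]_(x in _) _)%E.
apply/lee_addgt0Pr => e e0.
have [r /andP[r0 rt] ure] := u0 e t e0 t0.
pose d := l * t `^ (- q / p).
have d0 : 0 < d by rewrite mulr_gt0// powR_gt0.
have qk : q * (p - 1) = p - 1 - beta.
  by rewrite /q /qexp; field; rewrite subr_eq0 gt_eqF.
have tk (c1 c2 : R) : c1 + c2 = k -> t `^ c1 * t `^ c2 = t `^ k.
  by move=> <-; rewrite powRD// (gt_eqF t0) implybT.
have E1 : d * (t `^ q / q) = t `^ k * (l / q).
  rewrite /d -(tk (- q / p) q); first by field; rewrite gt_eqF.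
  by rewrite /k -qk; field; rewrite gt_eqF.
have E2 : d `^ (1 - p) = t `^ k * l `^ (1 - p).
  rewrite /d powRM ?powR_ge0 ?(ltW l0)// -powRrM mulrC; congr (_ `^ _ * _).
  by rewrite /k -qk; field; rewrite gt_eqF.
apply: (@le_trans _ _ (`|u t - u r|%:E + `|u r|%:E)%E).
  by rewrite -EFinD lee_fin -{1}(subrK (u r) (u t)) ler_normD.
apply: leeD; last by rewrite lee_fin ltW.
apply: (le_trans (weak_deriv_FTC_le cu uv r0 (ltW rt))).
apply: (le_trans (young_integral p1 bp r0 (ltW rt) d0 mv)).
have A0 : (0 <= A)%E by apply: integral_ge0 => x _; rewrite lee_fin wpow_ge0.
have h1 : (0 <= (l / q)%:E)%E by rewrite lee_fin divr_ge0 ?ltW.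
have h2 : (0 <= (l `^ (1 - p))%:E * A)%E by rewrite mule_ge0// lee_fin powR_ge0.
rewrite -/q E1 E2 (ge0_muleDr _ h1 h2).
rewrite -EFinM muleA -EFinM; apply: leeD => //; apply: lee_wpmul2l.
  by rewrite lee_fin mulr_ge0 ?powR_ge0.
have sub : `]0, t] `<=` Rp by move=> x /=; rewrite in_itv/= => /andP[].
apply: ge0_subset_integral => //.
- apply: measurable_wpow; apply: measurable_funS mv => //; exact: measurable_Rplus.
- by move=> x _; rewrite lee_fin wpow_ge0.
- by apply: subset_itvr; rewrite bnd_simp.
Qed.

(** Dominated convergence for the restrictions of [f] to sets that every point
eventually leaves. *)
Lemma tail_small (f : R -> R) (B : nat -> set R) : measurable_fun Rp f ->
  (forall x, 0 <= f x) -> (\int[mu]_(x in Rp) (f x)%:E < +oo)%E ->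
  (forall n, measurable (B n)) ->
  (forall x, 0 < x -> \forall n \near \oo, ~ B n x) ->
  forall e : R, 0 < e -> \forall n \near \oo,
    (\int[mu]_(x in Rp `&` B n) (f x)%:E < e%:E)%E.
Proof.
move=> mf f0 foo mB Bx e e0.
have mR := @measurable_Rplus R.
have fi : mu.-integrable Rp (EFin \o f).
  apply/integrableP; split; first exact/measurable_EFinP.
  by under eq_integral do rewrite gee0_abs ?lee_fin//.
have := @dominated_cvg _ _ _ mu Rp mR (fun n => (EFin \o f) \_ (B n)) (cst 0%E) (EFin \o f).
have h1 n : measurable_fun Rp ((EFin \o f) \_ (B n)).
  by apply/measurable_restrict => //; apply: measurable_funS (measurable_int _ fi) => //.
have h2 x : Rp x -> ((EFin \o f) \_ (B n)) x @[n --> \oo] --> 0%E.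
  move=> x0; apply: cvg_near_cst; near=> n; rewrite patchE memNset//.
  by near: n; exact: Bx.
have h3 n x : Rp x -> (`|((EFin \o f) \_ (B n)) x| <= (EFin \o f) x)%E.
  move=> _; rewrite patchE; case: ifP => _.
    by rewrite gee0_abs ?lee_fin//=.
  by rewrite abse0 lee_fin.
move=> /(_ h1 h2 (fun x _ => isT) fi h3).
rewrite integral_cst// mul0e => /fine_cvgP[fin /cvgrPdist_lt/(_ e e0)] cv.
near=> n.
have : `|0 - fine (\int[mu]_(x in Rp) ((EFin \o f) \_ (B n)) x)%E| < e.
  by near: n; exact: cv.
have : (\int[mu]_(x in Rp) ((EFin \o f) \_ (B n)) x)%E \is a fin_num.
  by near: n; exact: fin.
rewrite -integral_mkcondr => fn; rewrite sub0r normrN => h.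
rewrite -(fineK fn) lte_fin; exact: le_lt_trans (ler_norm _) h.
Unshelve. all: by end_near. Qed.

End Young.
(** * Elements of the closure vanish at 0 *)

Section ClosureIncluded.
Variable R : realType.
Implicit Types (f g h u v phi chi : R -> R) (n k : nat) (t x a b p beta : R).
Notation mu := (@lebesgue_measure R).
Notation Rp := (@Rplus R).

Lemma limf_einf_right0 f : (forall t, 0 <= f t) ->
  limf_einf (fun t => (f t)%:E) 0^'+ = 0%E <->
  (forall e d : R, 0 < e -> 0 < d -> exists2 r, 0 < r < d & f r < e).
Proof.
move=> f0; rewrite limf_einfE; split=> [lim e d e0 d0|small].
  apply: contrapT => nex.
  have : (e%:E <= 0)%E; last by rewrite lee_fin leNgt e0.
  rewrite -lim; apply: (@le_trans _ _ (ereal_inf [set (f t)%:E | t in [set t | 0 < t < d]])).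
    apply: le_ereal_inf_tmp => _ [t td <-]; rewrite lee_fin leNgt; apply/negP => fe.
    by apply: nex; exists t.
  apply: ereal_sup_ubound; exists [set t | 0 < t < d] => //.
  near=> t => /=; apply/andP; split; near: t; first exact: nbhs_right_gt.
  exact: nbhs_right_lt.
apply/eqP; rewrite eq_le; apply/andP; split.
  apply: ge_ereal_sup => _ [V FV <-]; apply/lee_addgt0Pr => e e0; rewrite add0e.
  have [d /= d0 dV] := FV.
  have [r /andP[r0 rd] fre] := small e d e0 d0.
  have Vr : V r by apply: dV => //; rewrite /= sub0r normrN gtr0_norm.
  apply: (@le_trans _ _ (f r)%:E); last by rewrite lee_fin ltW.
  by apply: ereal_inf_lbound; exists r.
apply: (@le_trans _ _ (ereal_inf [set (f t)%:E | t in setT])).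
  by apply: le_ereal_inf_tmp => _ [t _ <-]; rewrite lee_fin.
apply: ereal_sup_ubound; exists setT => //; exact: filterT.
Unshelve. all: by end_near. Qed.

Lemma W11locP u : W11loc u -> [/\ forall x, 0 < x -> {for x, continuous u},
  locally_integrable Rp u & is_weak_deriv u (weak_deriv u)].
Proof.
move=> [/within_Rplus cu lu [v uv]]; split => //.
exact: weak_deriv_spec uv.
Qed.

Lemma W1pP p beta u : 0 < p -> W1p p beta u <->
  [/\ W11loc u, (energy p beta u < +oo)%E &
      (energy p beta (weak_deriv u) < +oo)%E].
Proof.
move=> p0; have n0 f : (0 <= wLp_norm p beta f)%E by exact: poweR_ge0.
split=> [[wu]|[wu e1 e2]].
  rewrite /W1p_norm => lt; split => //; apply/wLp_norm_fin => //.
  - by apply: le_lt_trans lt; rewrite leeDl.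
  - by apply: le_lt_trans lt; rewrite leeDr.
by split => //; rewrite /W1p_norm lte_add_pinfty//; apply/wLp_norm_fin.
Qed.

Lemma weak_deriv_sub_smooth u phi : W11loc u -> smooth phi ->
  (forall x, 0 < x -> {for x, continuous (u \- phi)}) /\
  is_weak_deriv (u \- phi) (weak_deriv u \- derive1 phi).
Proof.
move=> /W11locP[cu lu uv] sphi; have cphi := smooth_continuous sphi.
split; first by move=> x x0; apply: cvgB; [exact: cu|exact: cphi].
apply: is_weak_derivB => //; last exact: smooth_weak_deriv.
by apply: loc_integrable_cont => x _; exact: cphi.
Qed.

(** Near [0] a test function is [0], so [u] coincides there with its difference to
the test function, which [sup_bound] makes uniformly small. *)
Lemma W1p0_small_near0 p beta u : 1 < p -> beta < p - 1 -> W1p0 p beta u ->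
  small_near0 u.
Proof.
move=> p1 bp [[wu _] appr] e d e0 d0.
have p0 : 0 < p by lra.
set Q := 2 `^ qexp p beta / qexp p beta.
have Q0 : 0 < Q by rewrite divr_gt0 ?powR_gt0 ?qexp_gt0.
(* with this choice each of the two terms of sup_bound is at most e / 4 *)
pose dl := e / (8 * Q).
have dl0 : 0 < dl by rewrite divr_gt0// mulr_gt0.
pose E0 := e / 8 / dl `^ (1 - p).
have E00 : 0 < E0 by rewrite divr_gt0 ?powR_gt0// divr_gt0.
pose e' := E0 `^ p^-1.
have e'0 : 0 < e' by rewrite powR_gt0.
have e'p : e' `^ p = E0 by rewrite -powRrM mulVf ?gt_eqF// powRr1// ltW.
have [phi /test_funP[sphi [a [b [a0 ab phi0]]]] near] := appr _ e'0.
have [cf fg] := weak_deriv_sub_smooth wu sphi.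
have n0 f : (0 <= wLp_norm p beta f)%E by exact: poweR_ge0.
have en1 : (energy p beta (u \- phi)%R < E0%:E)%E.
  rewrite -e'p; apply: energy_lt => //; apply: le_lt_trans near.
  by rewrite /W1p_norm leeDl.
have en2 : (energy p beta (weak_deriv (u \- phi)%R) < E0%:E)%E.
  rewrite -e'p; apply: energy_lt => //; apply: le_lt_trans near.
  by rewrite /W1p_norm leeDr.
pose r := Num.min 1 (Num.min a d) / 2.
have [r0 r1 ra rd] : [/\ 0 < r, r <= 1, r < a & r < d].
  have m0 : 0 < Num.min 1 (Num.min a d) by rewrite !lt_min ltr01 a0.
  have : Num.min 1 (Num.min a d) <= 1 by rewrite ge_min lexx.
  have : Num.min 1 (Num.min a d) <= a by rewrite !ge_min lexx orbT.
  have : Num.min 1 (Num.min a d) <= d by rewrite !ge_min lexx !orbT.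
  by rewrite /r => *; split; lra.
exists r; first by rewrite r0.
have := sup_bound p1 bp cf (weak_deriv_spec fg) r0 r1 dl0.
have -> : (u \- phi) r = u r.
  by rewrite /= phi0 ?subr0// negb_and -leNgt (ltW ra).
rewrite -/Q => h; rewrite -lte_fin; apply: (le_lt_trans h).
have dlQ : 2 * (dl * Q) = e / 4 by rewrite /dl; field; rewrite gt_eqF.
have dlE : dl `^ (1 - p) * (E0 + E0) = e / 4.
  by rewrite /E0; field; rewrite gt_eqF ?powR_gt0.
apply: (@le_lt_trans _ _ (e / 4 + e / 4)%:E); last by rewrite lte_fin; lra.
rewrite dlQ EFinD leeD2l// -[in leRHS]dlE EFinM EFinD.
apply: lee_wpmul2l; first by rewrite lee_fin powR_ge0.
by apply: leeD; exact: ltW.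
Qed.

Lemma small_near0_bound p beta u v : 1 < p -> beta < p - 1 ->
  (forall x, 0 < x -> {for x, continuous u}) -> is_weak_deriv u v ->
  small_near0 u -> (energy p beta v < +oo)%E ->
  exists2 C, 0 < C & forall t, 0 < t -> `|u t| <= C * t `^ ((p - 1 - beta) / p).
Proof.
move=> p1 bp cu uv u0 ev; have q0 := qexp_gt0 p1 bp.
have mv : measurable_fun Rp v by case: uv => -[].
have ev0 := energy_ge0 p beta v.
have efin : energy p beta v \is a fin_num by rewrite ge0_fin_numE.
exists ((qexp p beta)^-1 + fine (energy p beta v)).
  by rewrite ltr_wpDr ?fine_ge0// invr_gt0.
move=> t t0; rewrite -lee_fin.
apply: (le_trans (hardy_bound p1 bp cu uv u0 t0 ltr01)).
rewrite powR1 mul1e mul1r [X in (_ <= X%:E)%E]mulrC [X in (_ <= X)%E]EFinM; apply: lee_wpmul2l.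
  by rewrite lee_fin powR_ge0.
rewrite EFinD fineK// leeD2l// /energy; apply: ge0_subset_integral => //.
- exact: measurable_Rplus.
- exact: measurable_wpow.
- by move=> x _; rewrite lee_fin wpow_ge0.
- by move=> x /=; rewrite in_itv/= => /andP[].
Qed.

(** The exponents [(p - 1 - beta) / p] and [sexp p alpha beta] add up to
[1 - `|alpha|], which is positive. *)
Lemma W1p0_sub_Wab p alpha beta : 1 < p -> -1 < alpha -> alpha < 0 ->
  beta < `|alpha| * p - 1 -> W1p0 p beta `<=` Wab p alpha beta.
Proof.
move=> p1 a1 a0 bap u u0.
have p0 : 0 < p by lra.
have na : `|alpha| = - alpha by rewrite ltr0_norm.
have bp : beta < p - 1 by rewrite na in bap; nra.
have small := W1p0_small_near0 p1 bp u0.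
have [wu _] := u0; split => //.
have [/W11locP[cu _ uv] _ ev] := (W1pP _ _ p0).1 wu.
have [C C0 uC] := small_near0_bound p1 bp cu uv small ev.
apply/limf_einf_right0; first by move=> t; rewrite mulr_ge0 ?powR_ge0.
move=> e d e0 d0.
pose k := 1 - `|alpha|.
have k0 : 0 < k by rewrite /k na; lra.
pose e1 := (e / (2 * C)) `^ k^-1.
have eC0 : 0 < e / (2 * C) by rewrite divr_gt0// mulr_gt0.
have e10 : 0 < e1 by rewrite powR_gt0.
pose r := Num.min e1 (d / 2).
have r0 : 0 < r by rewrite lt_min e10 divr_gt0.
exists r; first by rewrite r0/= gt_min orbC ltr_pdivrMr// ltr_pMr// ltr1n.
apply: (@le_lt_trans _ _ (C * r `^ k)).
  have -> : k = (p - 1 - beta) / p + sexp p alpha beta.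
    by rewrite /k /sexp; field; rewrite gt_eqF.
  rewrite powRD; last by rewrite (gt_eqF r0) implybT.
  by rewrite mulrA; apply: ler_wpM2r; [exact: powR_ge0|exact: uC].
apply: (@le_lt_trans _ _ (C * (e / (2 * C)))); last first.
  have -> : C * (e / (2 * C)) = e / 2 by field; rewrite gt_eqF.
  by lra.
apply: ler_wpM2l; first exact: ltW.
have -> : e / (2 * C) = e1 `^ k by rewrite -powRrM mulVf ?gt_eqF// powRr1// ltW.
apply: ge0_ler_powR; rewrite ?nnegrE ?(ltW k0) ?(ltW r0) ?(ltW e10)//.
by rewrite ge_min lexx.
Qed.

End ClosureIncluded.
(** * Density of smooth functions in the weighted L^p space *)

Section Density.
Variable R : realType.
Implicit Types (f g h u v w z phi chi : R -> R) (n k : nat) (t x a b p beta : R).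
Notation mu := (@lebesgue_measure R).
Notation Rp := (@Rplus R).

(** Let [c] range over the points up to which an approximation exists that is
constant equal to [g c] from [c] on. Adding a small multiple of a step on
[`[c, c']] moves [c] past any supremum other than [b]. *)
Lemma smooth_approx g a b (e : R) : continuous g -> a <= b -> 0 < e ->
  exists2 w, smooth w & forall x, a <= x <= b -> `|w x - g x| <= e.
Proof.
move=> cg ab e0.
have [th [C [sth th0 th1 th01 _]]] := smooth_step_exists R.
pose P c w := [/\ smooth w, forall x, a <= x <= c -> `|w x - g x| <= e &
  forall x, c <= x -> w x = g c].
pose S := [set c | a <= c <= b /\ exists w, P c w].
(* a constant function is an approximation up to a *)
have Sa : S a.
  split; first by rewrite lexx.
  exists (fun=> g a); split => //; first exact: smooth_cst.
  move=> x /andP[ax xa]; have -> : x = a by lra.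
  by rewrite subrr normr0 ltW.
have bS : has_ubound S by exists b => c [/andP[]].
have hS : has_sup S by split => //; exists a.
pose s := sup S.
have as_ : a <= s by apply: ub_le_sup.
have sb : s <= b by apply: ge_sup; [exists a|move=> c [/andP[]]].
have e4 : 0 < e / 4 by lra.
have [d /= d0 gd] : exists2 d, 0 < d & forall x, `|s - x| < d -> `|g s - g x| <= e / 4.
  have /cvgrPdist_le/(_ _ e4) := cg s.
  by move=> /nbhs_ballP[d /= d0 hd]; exists d => // x sx; apply: hd.
have [c Sc sc] := sup_adherent d0 hS.
have cs : c <= s by apply: ub_le_sup.
have [/andP[ac cb] [w [sw wg wc]]] := Sc.
rewrite -/s in sc.
pose c' := Num.min b (s + d / 2).
have c'b : c' <= b by rewrite ge_min lexx.
have c's : c' <= s + d / 2 by rewrite ge_min lexx orbT.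
have [c'c|cc'] := leP c' c.
  have -> : b = c.
    move: c'c; rewrite /c' ge_min => /orP[|]; lra.
  by exists w.
pose l := c' - c.
have l0 : 0 < l by rewrite subr_gt0.
pose w' x := w x + (g c' - g c) * th (l^-1 * x + - (c / l)).
have sw' : smooth w'.
  by apply: smoothD => //; apply: smoothZ; exact: smooth_affine.
have thE x : l^-1 * x + - (c / l) = (x - c) / l by rewrite mulrC mulrBl.
have thc x : x <= c -> th (l^-1 * x + - (c / l)) = 0.
  by move=> xc; rewrite th0// thE ler_pdivrMr// mul0r subr_le0.
have thc' x : c' <= x -> th (l^-1 * x + - (c / l)) = 1.
  by move=> xc; rewrite th1// thE ler_pdivlMr// mul1r lerB.
have gg x y : c <= x <= c' -> c <= y <= c' -> `|g x - g y| <= e / 2.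
  move=> /andP[cx xc'] /andP[cy yc'].
  have hx : `|g s - g x| <= e / 4 by apply: gd; rewrite ltr_norml; lra.
  have hy : `|g s - g y| <= e / 4 by apply: gd; rewrite ltr_norml; lra.
  by move: hx hy; rewrite !ler_norml; lra.
have P' : P c' w'.
  split => //.
  - move=> x /andP[ax xc']; rewrite /w'; have [xc|cx] := leP x c.
      by rewrite thc// mulr0 addr0; apply: wg; rewrite ax.
    rewrite wc; last exact: ltW.
    have cx' := ltW cx; have ccc := ltW cc'.
    have := gg c x; rewrite lexx cx' ccc xc' => /(_ isT isT) h1.
    have := gg c' c; rewrite !lexx ccc => /(_ isT isT) h2.
    have := th01 (l^-1 * x + - (c / l)); move: (th _) => r /andP[r0 r1].
    have h3 : `|(g c' - g c) * r| <= e / 2.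
      rewrite normrM (ger0_norm r0) -[leRHS]mulr1; exact: ler_pM.
    by move: h1 h3; rewrite !ler_norml; lra.
  - move=> x xc; rewrite /w' thc'// mulr1 wc ?(le_trans (ltW cc'))//; lra.
have Sc' : S c' by split; [rewrite c'b andbT; lra|exists w'].
have c's' : c' <= s by apply: ub_le_sup.
have c'E : c' = b.
  by move: c's'; rewrite /c' minEle; case: ifP => //; lra.
by exists w' => //; rewrite -c'E; have [] := P'.
Qed.

Lemma powR_itv_le beta a b t : 0 < a -> a <= t <= b ->
  t `^ beta <= a `^ beta + b `^ beta.
Proof.
move=> a0 /andP[at_ tb]; have t0 : 0 < t by lra.
have [b0|b0] := leP 0 beta.
  rewrite (@le_trans _ _ (b `^ beta))//; last by rewrite lerDr powR_ge0.
  by apply: ge0_ler_powR => //; rewrite nnegrE; lra.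
rewrite (@le_trans _ _ (a `^ beta))//; last by rewrite lerDl powR_ge0.
rewrite -(opprK beta) (powRN t) (powRN a) lef_pV2 ?posrE ?powR_gt0//.
by apply: ge0_ler_powR => //; rewrite ?nnegrE; lra.
Qed.

Lemma energy_supp p beta f (B : set R) : 0 < p ->
  (forall x, Rp x -> ~ B x -> f x = 0) ->
  energy p beta f = (\int[mu]_(x in Rp `&` B) (wpow p beta f x)%:E)%E.
Proof.
move=> p0 f0; rewrite integral_mkcondr; apply: eq_integral => x; rewrite inE => x0.
rewrite patchE; case: ifPn => //; rewrite notin_setE => nB.
by rewrite /wpow (f0 _ x0 nB) normr0 powR0 ?gt_eqF// mul0r.
Qed.

Lemma energy_le_on p beta f g (C : R) (B : set R) : 0 < p -> 0 <= C ->
  measurable B -> measurable_fun Rp f -> measurable_fun Rp g ->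
  (forall x, Rp x -> B x -> `|f x| <= C * `|g x|) ->
  (forall x, Rp x -> ~ B x -> f x = 0) ->
  (energy p beta f <= (C `^ p)%:E *
    \int[mu]_(x in Rp `&` B) (wpow p beta g x)%:E)%E.
Proof.
move=> p0 C0 mB mf mg fg f0; rewrite (energy_supp _ p0 f0).
have mR := @measurable_Rplus R; have mRB : measurable (Rp `&` B) by exact: measurableI.
have mG : measurable_fun (Rp `&` B) (EFin \o wpow p beta g).
  by apply: measurable_funS (measurable_wpow p beta mg) => //; exact: subIsetl.
rewrite -ge0_integralZl_EFin//; last 2 first.
- by move=> x _; rewrite lee_fin wpow_ge0.
- exact: powR_ge0.
apply: ge0_le_integral => //.
- by move=> x _; rewrite lee_fin wpow_ge0.
- by apply: measurable_funS (measurable_wpow p beta mf) => //; exact: subIsetl.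
- exact: measurable_funeM.
- move=> x [x0 Bx]; rewrite -EFinM lee_fin /wpow mulrA -powRM//.
  apply: ler_wpM2r; first exact: powR_ge0.
  by apply: ge0_ler_powR; rewrite ?nnegrE ?mulr_ge0 ?(ltW p0)// fg.
Qed.

(** The truncation of [x] to [`[- M, M]], written with absolute values so that
continuity is immediate. *)
Definition clip (M x : R) : R := (`|x + M| - `|x - M|) / 2.

Lemma clip_le (M x : R) : 0 <= M -> `|clip M x| <= M.
Proof.
move=> M0; rewrite /clip ler_norml.
by case: (ger0P (x + M)) => h1; case: (ger0P (x - M)) => h2; apply/andP; split; lra.
Qed.

Lemma clip_dist (M x y : R) : 0 <= M -> `|y| <= M -> `|y - clip M x| <= `|y - x|.
Proof.
move=> M0; rewrite /clip ler_norml => /andP[y1 y2].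
by case: (ger0P (x + M)) => h1; case: (ger0P (x - M)) => h2;
  case: (ger0P (y - x)) => h3; rewrite ler_norml; apply/andP; split; lra.
Qed.

Lemma clip_continuous (M : R) g : continuous g -> continuous (clip M \o g).
Proof.
move=> cg x; rewrite /clip /comp; apply: cvgM; last exact: cvg_cst.
by apply: cvgB; apply: cvg_norm; [apply: cvgD|apply: cvgB]; [exact: cg|exact: cvg_cst|exact: cg|exact: cvg_cst].
Qed.

Lemma cutoff_exists a b : 0 < a -> a < b ->
  exists chi, [/\ smooth chi, supp_in (a / 2) (b + 1) chi,
    forall x, 0 <= chi x <= 1 & forall x, a <= x <= b -> chi x = 1].
Proof.
move=> a0 ab; have [th [C [sth th0 th1 th01 _]]] := smooth_step_exists R.
pose f x := th (2 / a * x + - 1); pose g x := th (-1 * x + (b + 1)).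
have f1 x : a <= x -> f x = 1.
  move=> ax; apply: th1; have : 1 <= a^-1 * x by rewrite mulrC ler_pdivlMr// mul1r.
  by move: (a^-1) => c; lra.
have f0 x : x <= a / 2 -> f x = 0.
  move=> ax; apply: th0.
  have : a^-1 * x <= 2^-1 by rewrite mulrC ler_pdivrMr//; lra.
  by move: (a^-1) => c; lra.
have g1 x : x <= b -> g x = 1 by move=> xb; apply: th1; lra.
have g0 x : b + 1 <= x -> g x = 0 by move=> xb; apply: th0; lra.
exists (fun x => f x * g x); split.
- by apply: smoothM; exact: smooth_affine.
- move=> x; rewrite negb_and -!leNgt => /orP[/f0->|/g0->]; by rewrite ?mul0r ?mulr0.
- move=> x; have /andP[h1 h2] := th01 (2 / a * x + - 1).
  have /andP[h3 h4] := th01 (-1 * x + (b + 1)); rewrite /f /g mulr_ge0//=.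
  by rewrite -[leRHS]mulr1 ler_pM.
- by move=> x /andP[xa xb]; rewrite f1// g1// mulr1.
Qed.

(** Approximate [z] by a continuous function in [L^1], truncate it at [M], smooth it,
and cut it off outside [`[a, b]]. All functions involved being bounded by a
multiple of [M], the [p]-th power of the error is at most a constant times the
error itself. *)
Lemma bounded_density p beta z a b (M e : R) : 1 < p -> 0 < a -> a < b -> 0 < M ->
  measurable_fun Rp z -> (forall x, `|z x| <= M) ->
  (forall x, ~~ (a <= x <= b) -> z x = 0) -> 0 < e ->
  exists w, [/\ smooth w, supp_in (a / 2) (b + 1) w &
    (energy p beta (z \- w)%R < e%:E)%E].
Proof.
move=> p1 a0 ab M0 mz zM z0 e0.
have p0 : 0 < p by lra.
set a' := a / 2; set b' := b + 1.
have a'0 : 0 < a' by rewrite divr_gt0.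
have a'b' : a' <= b' by rewrite /a' /b'; lra.
have L0 : 0 < b' - a' by rewrite /a' /b'; lra.
pose E : set R := [set` `[a', b']].
have subE : E `<=` Rp by exact: itv_sub_Rplus.
have mE : measurable E by exact: measurable_itv.
have mzE : measurable_fun E z.
  by apply: measurable_funS mz => //; exact: measurable_Rplus.
have muE : mu E = (b' - a')%:E.
  by rewrite /E lebesgue_measure_itv/= lte_fin -subr_gt0 L0 EFinB.
have iz : mu.-integrable E (EFin \o z).
  apply: (@le_integrable _ _ _ mu E mE (EFin \o z) (EFin \o (fun _ : R => M))).
  - exact/measurable_EFinP.
  - by move=> x _ /=; rewrite lee_fin (le_trans (zM x))// ler_norm.
  - by apply: continuous_itv_integrable => x; exact: cvg_cst.
pose T := a' `^ beta + b' `^ beta.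
have T0 : 0 < T by rewrite addr_gt0 ?powR_gt0//; lra.
(* y `^ p <= (3 * M) `^ (p - 1) * y for 0 <= y <= 3 * M *)
pose K := T * (3 * M) `^ (p - 1).
have K0 : 0 < K by rewrite mulr_gt0// powR_gt0// mulr_gt0.
pose e1 := Num.min M (e / (4 * K * (b' - a'))).
have KL0 : 0 < 4 * K * (b' - a') by rewrite mulr_gt0// mulr_gt0.
have e10 : 0 < e1 by rewrite lt_min M0 divr_gt0.
have e1M : e1 <= M by rewrite ge_min lexx.
have e1e : K * (e1 * (b' - a')) <= e / 4.
  have : e1 <= e / (4 * K * (b' - a')) by rewrite ge_min lexx orbT.
  by rewrite ler_pdivlMr//; lra.
have e2 : 0 < e / (4 * K) by rewrite divr_gt0// mulr_gt0.
have muEoo : (mu E < +oo)%E by rewrite muE ltry.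
have [g_ [cg_ ig_ gz]] := approximation_continuous_integrable mE muEoo iz.
have [n gn] : exists n, (\int[mu]_(x in E) `|(z x - g_ n x)%:E| < (e / (4 * K))%:E)%E.
  have /fine_cvgP[fin /cvgrPdist_lt/(_ _ e2) cv] := gz.
  near \oo => n; exists n.
  have h1 : `|0 - fine (\int[mu]_(x in E) `|(z x - g_ n x)%:E|)%E| < e / (4 * K).
    by near: n; exact: cv.
  have h2 : (\int[mu]_(x in E) `|(z x - g_ n x)%:E|)%E \is a fin_num.
    by near: n; exact: fin.
  rewrite -(fineK h2) lte_fin; apply: le_lt_trans h1.
  by rewrite sub0r normrN ler_norm.
pose g := clip M \o g_ n.
have cg : continuous g by exact: clip_continuous.
have [w0 sw0 w0g] := smooth_approx cg a'b' e10.
have [chi [schi chi0 chi01 chi1]] := cutoff_exists a0 ab.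
pose w x := w0 x * chi x.
have sw : smooth w by exact: smoothM.
have w_0 : supp_in a' b' w by move=> x /chi0; rewrite /w => ->; rewrite mulr0.
exists w; split => //.
have zw x : E x -> `|z x - w x| <= `|z x - g_ n x| + e1 /\ `|z x - w x| <= 3 * M.
  move=> Ex; have xab' : a' <= x <= b' by move: Ex; rewrite /E/= in_itv.
  have zwx : `|z x - w x| <= `|z x - w0 x|.
    have -> : z x - w x = (z x - w0 x) * chi x.
      rewrite /w mulrBl; congr (_ - _).
      have [/chi1->|/z0->] := boolP (a <= x <= b); by rewrite ?mulr1 ?mul0r.
    have /andP[c0 c1] := chi01 x.
    by rewrite normrM (ger0_norm c0) -[leRHS]mulr1 ler_wpM2l.
  have h1 := w0g x xab'; have h2 := zM x; have h3 := clip_le (g_ n x) (ltW M0).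
  have h4 := clip_dist (g_ n x) (ltW M0) h2.
  have h5 : `|z x - w0 x| <= `|z x - g x| + `|w0 x - g x|.
    by rewrite (distrC (w0 x)) ler_distD.
  have h6 : `|z x - g x| <= `|z x| + `|g x| by exact: ler_normB.
  by rewrite /g /= in h1 h5 h6; split; lra.
have mw : measurable_fun Rp w.
  apply: measurable_funTS; apply: continuous_measurable_fun.
  exact: smooth_continuous sw.
have mgn : measurable_fun E (g_ n).
  by apply: measurable_funTS; exact: continuous_measurable_fun.
rewrite (@energy_supp _ _ _ E)//; last first.
  move=> x _ Ex; have xab : ~~ (a' <= x <= b').
    by apply/negP => h; apply: Ex; rewrite /E/= in_itv.
  rewrite /= w_0; last by apply: contra xab => /andP[/ltW-> /ltW->].
  rewrite z0 ?subrr//; apply: contra xab => /andP[ax xb].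
  by rewrite /a' /b'; apply/andP; split; lra.
have -> : Rp `&` E = E by apply/setIidPr.
apply: (@le_lt_trans _ _ (\int[mu]_(x in E) (K%:E * (`|(z x - g_ n x)%:E| + e1%:E)))%E).
  apply: ge0_le_integral => //.
  - by move=> x _; rewrite lee_fin wpow_ge0.
  - apply: measurable_wpow; apply: measurable_funB => //.
    by apply: measurable_funS mw => //; exact: measurable_Rplus.
  - apply: measurable_funeM; apply: emeasurable_funD => //.
    do 2 apply: measurableT_comp => //; exact: measurable_funB.
  - move=> x Ex; have [h1 h2] := zw x Ex.
    have xab' : a' <= x <= b' by move: Ex; rewrite /E/= in_itv.
    rewrite -EFinD -EFinM lee_fin /wpow /=; set y := `|z x - w x|.
    have y0 : 0 <= y by exact: normr_ge0.
    have p10 : 0 <= p - 1 by rewrite subr_ge0 ltW.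
    have yM : y `^ (p - 1) <= (3 * M) `^ (p - 1).
      by apply: ge0_ler_powR; rewrite ?nnegrE// mulr_ge0// ltW.
    rewrite -(mulr_powRB1 y0 p0) /K mulrC mulrCA [leRHS]mulrC.
    apply: ler_pM => //; first by rewrite mulr_ge0// powR_ge0.
    by apply: ler_pM; rewrite ?powR_ge0//; exact: powR_itv_le.
rewrite ge0_integralZl_EFin//; last 3 first.
- by move=> x _; rewrite adde_ge0// lee_fin ltW.
- apply: emeasurable_funD => //.
  do 2 apply: measurableT_comp => //; exact: measurable_funB.
- exact: ltW.
rewrite ge0_integralD//; last 2 first.
- do 2 apply: measurableT_comp => //; exact: measurable_funB.
- by move=> x _; rewrite lee_fin ltW.
have -> : (\int[mu]_(x in E) e1%:E = (e1 * (b' - a'))%:E)%E.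
  by rewrite (integral_cst mu mE) EFinM -muE.
apply: (@le_lt_trans _ _ (K%:E * ((e / (4 * K))%:E + (e1 * (b' - a'))%:E))%E).
  apply: lee_wpmul2l; first by rewrite lee_fin ltW.
  by apply: leeD => //; exact: ltW.
rewrite -EFinD -EFinM lte_fin mulrDr.
have -> : K * (e / (4 * K)) = e / 4 by field; rewrite gt_eqF.
by lra.
Unshelve. all: by end_near. Qed.

End Density.
(** * Approximation of compactly supported functions *)

Section Compact.
Variable R : realType.
Implicit Types (f g h u v w y z phi chi : R -> R) (n k : nat) (t x a b p beta : R).
Notation mu := (@lebesgue_measure R).
Notation Rp := (@Rplus R).

Lemma measurable_Rplus_cont f : continuous f -> measurable_fun Rp f.
Proof. by move=> cf; apply: measurable_funTS; exact: continuous_measurable_fun. Qed.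

(** The energy is not a norm; the factor [4 * 2 `^ p] absorbs the constant in
[energyD]. *)
Lemma energy_dist_lt p beta f g h (e : R) : 0 < p ->
  measurable_fun Rp f -> measurable_fun Rp g -> measurable_fun Rp h ->
  (energy p beta (f \- g)%R < (e / (4 * 2 `^ p))%:E)%E ->
  (energy p beta (g \- h)%R < (e / (4 * 2 `^ p))%:E)%E ->
  (energy p beta (f \- h)%R < e%:E)%E.
Proof.
move=> p0 mf mg mh fg gh.
have P0 : 0 < 2 `^ p :> R by rewrite powR_gt0.
have e0 : 0 < e.
  have := le_lt_trans (energy_ge0 _ _ _) fg.
  by rewrite lte_fin pmulr_lgt0// invr_gt0 mulr_gt0.
have -> : f \- h = (f \- g) \+ (g \- h) by apply/funext => x /=; rewrite addrA subrK.
apply: le_lt_trans (energyD beta p0 (measurable_funB mf mg) (measurable_funB mg mh)) _.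
apply: (@le_lt_trans _ _ ((2 `^ p)%:E * ((e / (4 * 2 `^ p))%:E + (e / (4 * 2 `^ p))%:E))%E).
  apply: lee_wpmul2l; first by rewrite lee_fin ltW.
  by apply: leeD; exact: ltW.
rewrite -EFinD -EFinM lte_fin.
have -> : 2 `^ p * (e / (4 * 2 `^ p) + e / (4 * 2 `^ p)) = e / 2.
  by field; rewrite gt_eqF.
by lra.
Qed.

(** Truncating [z] where [`|z x| > n.+1] changes its energy by a tail, which reduces
the claim to [bounded_density]. *)
Lemma energy_density p beta z a b (e : R) : 1 < p -> 0 < a -> a < b ->
  measurable_fun Rp z -> (forall x, ~~ (a <= x <= b) -> z x = 0) ->
  (energy p beta z < +oo)%E -> 0 < e ->
  exists w, [/\ smooth w, supp_in (a / 2) (b + 1) w &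
    (energy p beta (z \- w)%R < e%:E)%E].
Proof.
move=> p1 a0 ab mz z0 ez e0.
have p0 : 0 < p by lra.
have mR := @measurable_Rplus R.
pose B n : set R := Rp `&` [set x | n.+1%:R < `|z x|].
have mB n : measurable (B n).
  have -> : B n = Rp `&` (fun x => `|z x|) @^-1` `]n.+1%:R, +oo[.
    by apply/seteqP; split => x /=; rewrite /B/= in_itv/= andbT.
  have mn : measurable_fun Rp (fun x => `|z x|) by exact: measurableT_comp.
  by apply: mn => //; exact: measurable_itv.
have Bx x : 0 < x -> \forall n \near \oo, ~ B n x.
  move=> x0; have := nbhs_infty_gtr `|z x|; apply: filterS => n zn [_ /=].
  by rewrite ltNge => /negP; apply; rewrite (le_trans (ltW zn))// ler_nat.
set e' := e / (4 * 2 `^ p).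
have e'0 : 0 < e' by rewrite divr_gt0// mulr_gt0// powR_gt0.
have := tail_small (proj1 (measurable_EFinP _ _) (measurable_wpow p beta mz))
  (wpow_ge0 p beta z) ez mB Bx e'0.
move=> /filter_ex[n Bn].
pose zn x := if x \in B n then 0 else z x.
have znE : zn = z \_ (~` B n).
  apply/funext => x; rewrite patchE /zn; case: ifPn => xB; case: ifPn => //.
  - by rewrite inE => nB; move: xB; rewrite inE.
  - by rewrite notin_setE => nB; exfalso; apply: nB => Bx'; move: xB; rewrite notin_setE.
have mzn : measurable_fun Rp zn.
  rewrite znE; apply/measurable_restrict => //; first exact: measurableC.
  by apply: measurable_funS mz => //; exact: subIsetl.
have zn0 x : ~~ (a <= x <= b) -> zn x = 0 by rewrite /zn => /z0 ->; case: ifP.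
have znM x : `|zn x| <= n.+1%:R.
  rewrite /zn; case: ifPn => [_|]; first by rewrite normr0.
  rewrite notin_setE => nB; rewrite leNgt; apply/negP => h; apply: nB; split => //.
  have : a <= x <= b by apply: contraPT h => /z0 ->; rewrite normr0; apply/negP; rewrite -leNgt.
  by move=> /andP[ax _]; exact: lt_le_trans ax.
have n0 : 0 < n.+1%:R :> R by rewrite ltr0n.
have [w [sw w0 ew]] := bounded_density beta p1 a0 ab n0 mzn znM zn0 e'0.
exists w; split => //.
have mw := measurable_Rplus_cont (smooth_continuous sw).
apply: (energy_dist_lt p0 mz mzn mw _ ew).
apply: le_lt_trans Bn.
have H1 x : Rp x -> B n x -> `|(z \- zn) x| <= 1 * `|z x|.
  by move=> _ Bnx; rewrite mul1r /= /zn mem_set// subr0.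
have H0 x : Rp x -> ~ B n x -> (z \- zn) x = 0.
  by move=> _ Bnx; rewrite /= /zn memNset// subrr.
have := energy_le_on beta p0 ler01 (mB n) (measurable_funB mz mzn) mz H1 H0.
by rewrite powR1 mul1e.
Qed.

(** In [young_integral], first choose [d] to make the first summand small, then the
energy to make the second one small. *)
Lemma L1_small p beta a b (r : R) : 1 < p -> beta < p - 1 -> 0 < a -> a <= b ->
  0 < r -> exists2 e : R, 0 < e & forall h, measurable_fun Rp h ->
    (energy p beta h < e%:E)%E -> (\int[mu]_(x in `[a, b]) `|h x|%:E < r%:E)%E.
Proof.
move=> p1 bp a0 ab r0.
set X := b `^ qexp p beta / qexp p beta.
have b0 : 0 < b by lra.
have X0 : 0 < X by rewrite divr_gt0 ?powR_gt0 ?qexp_gt0.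
pose d := r / (4 * X).
have d0 : 0 < d by rewrite divr_gt0// mulr_gt0.
have D0 : 0 < d `^ (1 - p) by rewrite powR_gt0.
exists (r / 4 / d `^ (1 - p)); first by rewrite !divr_gt0.
move=> h mh eh; apply: le_lt_trans (young_integral p1 bp a0 ab d0 mh) _.
apply: (@le_lt_trans _ _ ((r / 4)%:E + (r / 4)%:E)%E); last first.
  by rewrite -EFinD lte_fin; lra.
apply: leeD.
  by rewrite -/X lee_fin /d le_eqVlt; apply/orP; left; apply/eqP; field; rewrite gt_eqF.
have -> : r / 4 = d `^ (1 - p) * (r / 4 / d `^ (1 - p)) by field; rewrite gt_eqF.
rewrite EFinM; apply: lee_wpmul2l; first by rewrite lee_fin ltW.
by apply: le_trans (ltW eh); exact: wpow_itv_le.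
Qed.

Lemma energy_bounded_le p beta f a b (r : R) : 0 < p -> 0 < a -> a < b -> 0 <= r ->
  measurable_fun Rp f -> (forall x, a <= x <= b -> `|f x| <= r) ->
  (forall x, ~~ (a <= x <= b) -> f x = 0) ->
  (energy p beta f <= (r `^ p * ((a `^ beta + b `^ beta) * (b - a)))%:E)%E.
Proof.
move=> p0 a0 ab r0 mf fr f0.
have subE : `[a, b] `<=` Rp by exact: itv_sub_Rplus.
have H1 x : Rp x -> `[a, b]%classic x -> `|f x| <= r * `|cst 1 x : R|.
  by move=> _ /=; rewrite in_itv/= => /fr; rewrite normr1 mulr1.
have H0 x : Rp x -> ~ `[a, b]%classic x -> f x = 0.
  by move=> _ /= xab; apply: f0; apply/negP => h; apply: xab; rewrite in_itv.
have m1 : measurable_fun Rp (cst (1 : R)) by exact: measurable_cst.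
apply: (le_trans (energy_le_on beta p0 r0 (measurable_itv `[a, b]) mf m1 H1 H0)).
rewrite [X in (_ <= X)%E]EFinM; apply: lee_wpmul2l; first by rewrite lee_fin powR_ge0.
have -> : Rp `&` [set` `[a, b]] = [set` `[a, b]] by apply/setIidPr.
set T := a `^ beta + b `^ beta.
have -> : ((T * (b - a))%:E = \int[mu]_(x in `[a, b]) T%:E)%E.
  rewrite (integral_cst mu (measurable_itv `[a, b])) EFinM; congr (_ * _)%E.
  by rewrite /= lebesgue_measure_itv/= lte_fin ab EFinB.
apply: ge0_le_integral => //.
- by move=> x _; rewrite lee_fin wpow_ge0.
- exact: measurable_wpow.
- move=> x /=; rewrite in_itv/= => xab.
  by rewrite lee_fin /wpow normr1 powR1 mul1r; exact: powR_itv_le.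
Qed.

Lemma small_powR p (C K e : R) : 0 < p -> 0 < C -> 0 < K -> 0 < e ->
  exists2 r : R, 0 < r & (r * C) `^ p * K < e.
Proof.
move=> p0 C0 K0 e0; have h0 : 0 < e / (2 * K) by rewrite divr_gt0// mulr_gt0.
exists ((e / (2 * K)) `^ p^-1 / C); first by rewrite divr_gt0// powR_gt0.
rewrite divfK ?gt_eqF// -powRrM mulVf ?gt_eqF// powRr1 ?ltW//.
have -> : e / (2 * K) * K = e / 2 by field; rewrite gt_eqF.
by lra.
Qed.

(** Since [y] has compact support, [z] has integral [0]. A smooth [w] close to [z]
thus has small integral [c], and subtracting [c] times a step from the primitive
of [w] restores compact support at little cost. *)
Lemma derivative_density p beta y z a b (e : R) : 1 < p -> beta < p - 1 ->
  0 < a -> a < b -> (forall x, 0 < x -> {for x, continuous y}) ->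
  is_weak_deriv y z -> supp_in a b y ->
  (forall x, ~~ (a <= x <= b) -> z x = 0) ->
  (energy p beta z < +oo)%E -> 0 < e ->
  exists phi, [/\ smooth phi, supp_in (a / 2) (b + 1) phi &
    (energy p beta (z \- derive1 phi)%R < e%:E)%E].
Proof.
move=> p1 bp a0 ab cy yz y0 z0 ez e0.
have p0 : 0 < p by lra.
have liz : locally_integrable Rp z by case: yz.
have mz : measurable_fun Rp z by case: liz.
set a' := a / 2; set b' := b + 1.
have a'0 : 0 < a' by rewrite divr_gt0.
have a'b' : a' < b' by rewrite /a' /b'; lra.
have L0 : 0 < b' - a' by lra.
have [th [C [sth th0 th1 th01 dth]]] := smooth_step_exists R.
have C0 : 0 <= C by have /andP[] := dth 0; exact: le_trans.
pose K := (a' `^ beta + b' `^ beta) * (b' - a').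
have K0 : 0 < K by rewrite mulr_gt0// addr_gt0 ?powR_gt0//; lra.
set e' := e / (4 * 2 `^ p).
have e'0 : 0 < e' by rewrite divr_gt0// mulr_gt0// powR_gt0.
pose C' := C / (b' - a') + 1.
have C'0 : 0 < C' by rewrite ltr_wpDl// divr_ge0// ltW.
have [r r0 rK] := small_powR p0 C'0 K0 e'0.
have [e1 e10 small] := L1_small p1 bp a'0 (ltW a'b') r0.
have e20 : 0 < Num.min e' e1 by rewrite lt_min e'0.
have [w [sw w0 ew]] := energy_density p1 a0 ab mz z0 ez e20.
have cw := smooth_continuous sw.
have mw := measurable_Rplus_cont cw.
have ewe' : (energy p beta (z \- w)%R < e'%:E)%E.
  by apply: (lt_le_trans ew); rewrite lee_fin ge_min lexx.
have ewe1 : (energy p beta (z \- w)%R < e1%:E)%E.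
  by apply: (lt_le_trans ew); rewrite lee_fin ge_min lexx orbT.
have iw : mu.-integrable `[a', b'] (EFin \o w) by exact: continuous_itv_integrable.
have iz : mu.-integrable `[a', b'] (EFin \o z) by exact: loc_integrable_itv.
pose c := \int[mu]_(x in `[a', b']) w x.
have cr : `|c| < r.
  (* y vanishes at both ends, so the integral of its weak derivative is 0 *)
  have Iz : \int[mu]_(x in `[a', b']) z x = 0.
    rewrite -(weak_deriv_FTC cy yz a'0 a'b') !y0 ?subrr//.
    - by rewrite negb_and -leNgt /a'; apply/orP; left; lra.
    - by rewrite negb_and -!leNgt /b'; apply/orP; right; lra.
  have -> : c = - \int[mu]_(x in `[a', b']) (z x - w x).
    by rewrite RintegralB// Iz sub0r opprK.
  rewrite normrN -lte_fin; apply: le_lt_trans (small _ (measurable_funB mz mw) ewe1).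
  have izw : mu.-integrable `[a', b'] (EFin \o (fun x => z x - w x)).
    exact: (integrableB (mu := mu) (measurable_itv `[a', b']) iz iw).
  rewrite EFin_normr_Rintegral//.
  exact: (le_abse_integral mu (measurable_itv `[a', b']) (measurable_int mu izw)).
have [W [sW W' W0]] : exists W, [/\ smooth W, derive1 W = w & forall x, x <= a' -> W x = 0].
  by apply: smooth_primitive => // x xa; apply: w0; rewrite negb_and -leNgt xa.
pose l := (b' - a')^-1.
have l0 : 0 < l by rewrite invr_gt0.
pose T x := th (l * x + - (l * a')).
have sT : smooth T by exact: smooth_affine.
have dT x : derive1 T x = l * derive1 th (l * x + - (l * a')).
  rewrite derive1E; apply: derive_val.
  by apply: is_derive_affine; exact: smooth_is_derive.
pose phi x := W x - c * T x.
have sphi : smooth phi by apply: smoothB => //; exact: smoothZ.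
have dphi x : derive1 phi x = w x - c * derive1 T x.
  rewrite derive1E; apply: derive_val; rewrite -W'; apply: is_deriveB.
    exact: smooth_is_derive.
  by apply: (@is_deriveZ _ _ _ T); exact: smooth_is_derive.
have lE x : l * x + - (l * a') = (x - a') / (b' - a') by rewrite /l mulrBl ![_ / _]mulrC.
have Wb x : b' <= x -> W x = c.
  move=> bx; have -> : W x = W b'.
    apply/eqP; rewrite -subr_eq0 -smooth_FTC// W'; apply/eqP/Rintegral_itv0.
    by move=> t /andP[bt _]; apply: w0; rewrite negb_and -!leNgt bt orbT.
  by rewrite /c -W' smooth_FTC ?(ltW a'b')// (W0 a')// subr0.
exists phi; split => //.
  move=> x; rewrite negb_and -!leNgt => /orP[xa|bx]; rewrite /phi /T lE.
    by rewrite W0// th0 ?mulr0 ?subrr// ler_pdivrMr// mul0r subr_le0.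
  by rewrite Wb// th1 ?mulr1 ?subrr// ler_pdivlMr// mul1r lerB.
have mdphi : measurable_fun Rp (derive1 phi).
  exact: measurable_Rplus_cont (smooth_continuous (smooth_derive sphi)).
apply: (energy_dist_lt p0 mz mw mdphi ewe').
apply: (@le_lt_trans _ _ ((r * C') `^ p * K)%:E); last by rewrite lte_fin.
apply: energy_bounded_le => //.
- by rewrite mulr_ge0// ltW.
- exact: measurable_funB.
- move=> x _; rewrite /= dphi opprB addrC subrK normrM.
  apply: ler_pM => //; first exact: ltW.
  rewrite dT; have /andP[d1 d2] := dth (l * x + - (l * a')).
  rewrite ger0_norm ?mulr_ge0 ?(ltW l0)//.
  rewrite /C' ler_wpDr// mulrC; apply: ler_wpM2r => //; exact: ltW.
- move=> x xab; rewrite /= dphi opprB addrC subrK dT (step_derive0 th0 th1) ?mulr0//.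
  apply: contra xab; rewrite lE ler_pdivlMr// ler_pdivrMr// mul0r mul1r.
  by rewrite subr_ge0 lerBlDr subrK.
Qed.

(** By [L1_small], closeness of the derivatives entails uniform closeness of the
functions, because both vanish near the ends of the interval. *)
Lemma compact_density p beta y z a b (e : R) : 1 < p -> beta < p - 1 ->
  0 < a -> a < b -> (forall x, 0 < x -> {for x, continuous y}) ->
  is_weak_deriv y z -> supp_in a b y ->
  (forall x, ~~ (a <= x <= b) -> z x = 0) ->
  (energy p beta z < +oo)%E -> 0 < e ->
  exists phi, [/\ smooth phi, supp_in (a / 2) (b + 1) phi,
    (energy p beta (y \- phi)%R < e%:E)%E &
    (energy p beta (z \- derive1 phi)%R < e%:E)%E].
Proof.
move=> p1 bp a0 ab cy yz y0 z0 ez e0.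
have p0 : 0 < p by lra.
have liy := loc_integrable_cont cy.
have my : measurable_fun Rp y by case: liy.
have mz : measurable_fun Rp z by case: yz => -[].
set a' := a / 2; set b' := b + 1.
have a'0 : 0 < a' by rewrite divr_gt0.
have a'b' : a' < b' by rewrite /a' /b'; lra.
pose K := (a' `^ beta + b' `^ beta) * (b' - a').
have K0 : 0 < K by rewrite mulr_gt0 ?subr_gt0// addr_gt0 ?powR_gt0//; lra.
have [r r0 rK] := small_powR p0 ltr01 K0 e0; rewrite mulr1 in rK.
have [e1 e10 small] := L1_small p1 bp a'0 (ltW a'b') r0.
have e20 : 0 < Num.min e e1 by rewrite lt_min e0.
have [phi [sphi phi0 ephi]] := derivative_density p1 bp a0 ab cy yz y0 z0 ez e20.
have cphi := smooth_continuous sphi.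
have mphi := measurable_Rplus_cont cphi.
have mdphi : measurable_fun Rp (derive1 phi).
  exact: measurable_Rplus_cont (smooth_continuous (smooth_derive sphi)).
exists phi; split => //; last first.
  by apply: (lt_le_trans ephi); rewrite lee_fin ge_min lexx.
have ephi1 : (energy p beta (z \- derive1 phi)%R < e1%:E)%E.
  by apply: (lt_le_trans ephi); rewrite lee_fin ge_min lexx orbT.
have cd x : 0 < x -> {for x, continuous (y \- phi)}.
  by move=> x0; apply: cvgB; [exact: cy|exact: cphi].
have wd : is_weak_deriv (y \- phi) (z \- derive1 phi).
  apply: is_weak_derivB => //; last exact: smooth_weak_deriv.
  by apply: loc_integrable_cont => x _; exact: cphi.
have y0' x : ~~ (a' < x < b') -> y x = 0.
  move=> h; apply: y0; apply: contra h => /andP[ax xb].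
  by rewrite /a' /b'; apply/andP; split; lra.
apply: (@le_lt_trans _ _ (r `^ p * K)%:E); last by rewrite lte_fin.
apply: energy_bounded_le => //.
- exact: ltW.
- exact: measurable_funB.
- move=> x /andP[ax xb].
  have := weak_deriv_FTC_le cd wd a'0 ax.
  have -> : (y \- phi) a' = 0 by rewrite /= y0' ?phi0 ?subrr// ltxx.
  rewrite subr0 => h; rewrite -lee_fin; apply: (le_trans h).
  apply: le_trans (ltW (small _ (measurable_funB mz mdphi) ephi1)).
  apply: ge0_subset_integral => //.
  + do 2 apply: measurableT_comp => //; apply: measurable_funB.
      by apply: measurable_funS mz; [exact: measurable_Rplus|exact: itv_sub_Rplus].
    by apply: measurable_funS mdphi; [exact: measurable_Rplus|exact: itv_sub_Rplus].
  + by apply: subset_itvl; rewrite bnd_simp.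
- move=> x xab; have xab' : ~~ (a' < x < b').
    by apply: contra xab => /andP[/ltW-> /ltW->].
  by rewrite /= y0'// phi0// subrr.
Qed.

End Compact.
(** * Cutting off near 0 and near infinity *)

Section Cutoff.
Variable R : realType.
Implicit Types (f g h u v w y z phi chi : R -> R) (n k : nat) (t x a b p beta : R).
Notation mu := (@lebesgue_measure R).
Notation Rp := (@Rplus R).

(** The [p]-th power of [x `^ ((p - 1 - beta) / p - 1)] times the weight is [x^-1],
whose integral over [`[c^-1, 2 / c]] is at most [1], whatever [c] is. *)
Lemma cutoff_layer_le p beta f (c K : R) : 0 < p -> 0 < c -> 0 <= K ->
  measurable_fun Rp f ->
  (forall x, c^-1 <= x <= 2 / c -> `|f x| <= K * x `^ ((p - 1 - beta) / p - 1)) ->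
  (forall x, 0 < x -> ~~ (c^-1 <= x <= 2 / c) -> f x = 0) ->
  (energy p beta f <= (K `^ p)%:E)%E.
Proof.
move=> p0 c0 K0 mf fK f0.
have cV0 : 0 < c^-1 by rewrite invr_gt0.
set k := (p - 1 - beta) / p.
pose g (x : R) := x `^ (k - 1).
pose J : set R := [set` `[c^-1, 2 / c]].
have mJ : measurable J by exact: measurable_itv.
have JR : J `<=` Rp by exact: itv_sub_Rplus.
have mg : measurable_fun Rp g by apply: measurable_funTS; exact: measurable_powR.
have H1 x : Rp x -> J x -> `|f x| <= K * `|g x|.
  move=> x0; rewrite /J/= in_itv/= => xJ; rewrite [ `|g x|]ger0_norm ?powR_ge0//.
  exact: fK.
have H0 x : Rp x -> ~ J x -> f x = 0.
  move=> x0 xJ; apply: f0 => //; apply/negP => h; apply: xJ.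
  by rewrite /J/= in_itv.
apply: (le_trans (energy_le_on beta p0 K0 mJ mf mg H1 H0)).
rewrite -[leRHS]mule1; apply: lee_wpmul2l; first by rewrite lee_fin powR_ge0.
have -> : Rp `&` J = J by apply/setIidPr.
have -> : (1 = \int[mu]_(x in J) c%:E)%E.
  rewrite (integral_cst mu mJ) /J /= lebesgue_measure_itv/= lte_fin.
  have -> : c^-1 < 2 / c by lra.
  rewrite -EFinB -EFinM; congr (_%:E); field; exact: lt0r_neq0.
have mgJ : measurable_fun J g by apply: measurable_funS mg => //; exact: measurable_Rplus.
apply: ge0_le_integral => //.
- by move=> x _; rewrite lee_fin wpow_ge0.
- exact: measurable_wpow.
- move=> x Jx; have x0 : 0 < x := JR _ Jx.
  move: Jx; rewrite /J/= in_itv/= => /andP[cx _].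
  rewrite lee_fin /wpow /g ger0_norm ?powR_ge0// -powRrM -powRD; last first.
    by rewrite (gt_eqF x0) implybT.
  have -> : (k - 1) * p + beta = - 1 by rewrite /k; field; rewrite gt_eqF.
  by rewrite powR_inv1 ?(ltW x0)// -[leRHS]invrK lef_pV2 ?posrE.
Qed.

(** For large [c] take for [chi] the product of a rising step on [`[c^-1, 2 / c]]
and a falling step on [`[c, 2 * c]]. Where [chi] differs from [1] the energies of
[u] and [v] are tails. The falling step has bounded derivative, so its
contribution is also a tail. The rising step has a derivative of order [c], at
most a multiple of [x^-1] there, which [hardy_bound] compensates. *)
Lemma cutoff_energy p beta u v (e : R) : 1 < p -> beta < p - 1 ->
  (forall x, 0 < x -> {for x, continuous u}) -> is_weak_deriv u v ->
  small_near0 u -> (energy p beta u < +oo)%E -> (energy p beta v < +oo)%E ->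
  0 < e ->
  exists (chi : R -> R) a b, [/\ 0 < a /\ a < b, smooth chi /\ supp_in a b chi,
    (energy p beta (u \- (fun x => u x * chi x))%R < e%:E)%E &
    (energy p beta (v \- (fun x => v x * chi x + u x * derive1 chi x))%R
      < e%:E)%E].
Proof.
move=> p1 bp cu uv u0 eu ev e0.
have p0 : 0 < p by lra.
have q0 := qexp_gt0 p1 bp; set q := qexp p beta in q0.
have mu_ : measurable_fun Rp u by case: (loc_integrable_cont cu).
have mv : measurable_fun Rp v by case: uv => -[].
have [th [C [sth th0 th1 th01 dth]]] := smooth_step_exists R.
have C0 : 0 <= C by have /andP[] := dth 0; exact: le_trans.
pose C' := C + 1; have C'0 : 0 < C' by rewrite /C'; lra.
have P0 : 0 < 2 `^ p :> R by rewrite powR_gt0.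
pose e1 := e / (4 * 2 `^ p).
have e10 : 0 < e1 by rewrite divr_gt0// mulr_gt0.
pose e2 := e1 / (4 * 2 `^ p).
have e20 : 0 < e2 by rewrite divr_gt0// mulr_gt0.
have K10 : 0 < 4 * C' / q by rewrite divr_gt0// mulr_gt0.
have [l l0 lK] := small_powR p0 K10 ltr01 e20; rewrite mulr1 in lK.
have l1p : 0 < l `^ (1 - p) by rewrite powR_gt0.
(* below this energy of v, the bracket in hardy_bound is at most 2 * (l / q) *)
pose e3 := l / q / l `^ (1 - p).
have e30 : 0 < e3 by rewrite !divr_gt0.
have C'p : 0 < C' `^ p by rewrite powR_gt0.
(* contains the set where the cutoff of parameter n differs from 1 *)
pose B n : set R := [set` `]-oo, 2 / n%:R]] `|` [set` `[n%:R, +oo[].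
have mB n : measurable (B n) by apply: measurableU; exact: measurable_itv.
have Bx x : 0 < x -> \forall n \near \oo, ~ B n x.
  move=> x0; near=> n; rewrite /B/= !in_itv/= andbT => -[|].
    have : 2 / x < n%:R by near: n; exact: nbhs_infty_gtr.
    have : 0 < n%:R :> R by near: n; exact: nbhs_infty_gtr.
    move=> n0; rewrite ltr_pdivrMr// => h; by rewrite ler_pdivlMr// leNgt [x * _]mulrC h.
  have : x < n%:R by near: n; exact: nbhs_infty_gtr.
  by rewrite ltNge => /negP.
pose eu0 := Num.min e (e2 / C' `^ p).
pose ev0 := Num.min e1 e3.
have eu00 : 0 < eu0 by rewrite lt_min e0 divr_gt0.
have ev00 : 0 < ev0 by rewrite lt_min e10.
near \oo => n.
have Bu : (\int[mu]_(x in Rp `&` B n) (wpow p beta u x)%:E < eu0%:E)%E.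
  near: n; apply: tail_small => //; first by apply/measurable_EFinP; exact: measurable_wpow.
  by move=> x; exact: wpow_ge0.
have Bv : (\int[mu]_(x in Rp `&` B n) (wpow p beta v x)%:E < ev0%:E)%E.
  near: n; apply: tail_small => //; first by apply/measurable_EFinP; exact: measurable_wpow.
  by move=> x; exact: wpow_ge0.
have n2 : 2 < n%:R :> R by near: n; exact: nbhs_infty_gtr.
move: (mB n) Bu Bv; rewrite /B; set c : R := n%:R in n2 *.
set Bc := [set` _] `|` _ => mBc Bu Bv.
have c0 : 0 < c by lra.
have BcP x : ~ Bc x -> 2 / c < x < c.
  rewrite /Bc/= !in_itv/= andbT => h; apply/andP; split; rewrite ltNge; apply/negP => h'; apply: h.
    by left.
  by right.
pose chi1 x := th (c * x + - 1); pose chi2 x := 1 - th (c^-1 * x + - 1).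
have schi1 : smooth chi1 by exact: smooth_affine.
have schi2 : smooth chi2.
  by apply: smoothB; [exact: smooth_cst|exact: smooth_affine].
pose chi x := chi1 x * chi2 x.
have schi : smooth chi by exact: smoothM.
have d1 x : derive1 chi1 x = c * derive1 th (c * x + - 1).
  rewrite derive1E; apply: derive_val.
  by apply: is_derive_affine; exact: smooth_is_derive.
have d2 x : derive1 chi2 x = - (c^-1 * derive1 th (c^-1 * x + - 1)).
  rewrite derive1E; apply: derive_val; rewrite -(sub0r (c^-1 * _)).
  have dth' : is_derive x (1 : R) (fun t => th (c^-1 * t + - 1))
      (c^-1 * derive1 th (c^-1 * x + - 1)).
    by apply: is_derive_affine; exact: smooth_is_derive.
  have dc : is_derive x (1 : R) (cst (1 : R)) (0 : R) by exact: is_derive_cst.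
  exact: (is_deriveB dc dth').
have dchi x : derive1 chi x = chi1 x * derive1 chi2 x + chi2 x * derive1 chi1 x.
  by rewrite derive1E; apply: derive_val; apply: is_deriveM; exact: smooth_is_derive.
have chi101 x : 0 <= chi1 x <= 1 by exact: th01.
have chi201 x : 0 <= chi2 x <= 1 by rewrite /chi2; have := th01 (c^-1 * x + - 1); lra.
have chi11 x : 2 / c <= x -> chi1 x = 1.
  by rewrite ler_pdivrMr// => h; apply: th1; lra.
have chi10 x : x <= c^-1 -> chi1 x = 0.
  by rewrite -[c^-1]mul1r ler_pdivlMr// => h; apply: th0; lra.
have chi21 x : x <= c -> chi2 x = 1.
  move=> xc; rewrite /chi2 th0 ?subr0// mulrC subr_le0 ler_pdivrMr//; lra.
have chi20 x : 2 * c <= x -> chi2 x = 0.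
  by move=> xc; rewrite /chi2 th1 ?subrr// mulrC lerBrDr ler_pdivlMr//; lra.
have chiB x : ~ Bc x -> chi x = 1.
  by move=> /BcP/andP[h1 h2]; rewrite /chi chi11 ?chi21 ?mulr1// ltW.
have mchi : measurable_fun Rp chi by exact: measurable_Rplus_cont (smooth_continuous schi).
have mchi1 : measurable_fun Rp chi1 by exact: measurable_Rplus_cont (smooth_continuous schi1).
have mchi2 : measurable_fun Rp chi2 by exact: measurable_Rplus_cont (smooth_continuous schi2).
have mdchi1 : measurable_fun Rp (derive1 chi1).
  exact: measurable_Rplus_cont (smooth_continuous (smooth_derive schi1)).
have mdchi2 : measurable_fun Rp (derive1 chi2).
  exact: measurable_Rplus_cont (smooth_continuous (smooth_derive schi2)).
have chi01 x : 0 <= chi x <= 1.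
  have /andP[h1 h2] := chi101 x; have /andP[h3 h4] := chi201 x.
  by rewrite /chi mulr_ge0//= -[leRHS]mulr1 ler_pM.
have cutE f : measurable_fun Rp f -> (energy p beta (f \- (fun x => f x * chi x))%R <=
    \int[mu]_(x in Rp `&` Bc) (wpow p beta f x)%:E)%E.
  move=> mf.
  have H1 x : Rp x -> Bc x -> `|(f \- (fun x => f x * chi x)) x| <= 1 * `|f x|.
    move=> _ _; rewrite /= mul1r -[X in X - _]mulr1 -mulrBr normrM -[leRHS]mulr1.
    by apply: ler_wpM2l => //; have := chi01 x; rewrite ler_norml; lra.
  have H0 x : Rp x -> ~ Bc x -> (f \- (fun x => f x * chi x)) x = 0.
    by move=> _ /chiB; rewrite /= => ->; rewrite mulr1 subrr.
  have := energy_le_on beta p0 ler01 mBc (measurable_funB mf (measurable_funM mf mchi)) mf H1 H0.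
  by rewrite powR1 mul1e.
exists chi, c^-1, (2 * c); split.
- split; first by rewrite invr_gt0.
  by rewrite -[c^-1]mul1r ltr_pdivrMr//; nra.
- split => // x; rewrite negb_and -!leNgt => /orP[|] h; rewrite /chi.
    by rewrite chi10// mul0r.
  by rewrite chi20// mulr0.
- apply: le_lt_trans (cutE _ mu_) _; apply: (lt_le_trans Bu).
  by rewrite lee_fin ge_min lexx.
(* the two summands of u * derive1 chi, from the falling and the rising step *)
pose g1 x := u x * (chi1 x * derive1 chi2 x).
pose g2 x := u x * (chi2 x * derive1 chi1 x).
have mg1 : measurable_fun Rp g1 by apply: measurable_funM => //; exact: measurable_funM.
have mg2 : measurable_fun Rp g2 by apply: measurable_funM => //; exact: measurable_funM.
have eg1 : (energy p beta g1 < e2%:E)%E.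
  have H1 x : Rp x -> Bc x -> `|g1 x| <= C' * `|u x|.
    move=> _ _; rewrite /g1 normrM mulrC; apply: ler_wpM2r => //.
    have /andP[h1 h2] := chi101 x; rewrite normrM (ger0_norm h1) d2 normrN.
    have /andP[h3 h4] := dth (c^-1 * x + -1).
    have cV : 0 <= c^-1 by rewrite invr_ge0 ltW.
    have cV1 : c^-1 <= 1 by rewrite invf_le1//; lra.
    rewrite ger0_norm ?mulr_ge0//; apply: (@le_trans _ _ C); last by rewrite /C'; lra.
    rewrite -[leRHS]mul1r; apply: ler_pM => //; first by rewrite mulr_ge0.
    by rewrite -[leRHS]mul1r; apply: ler_pM.
  have H0 x : Rp x -> ~ Bc x -> g1 x = 0.
    move=> x0 /BcP/andP[h1 h2]; rewrite /g1 d2 (step_derive0 th0 th1) ?mulr0 ?oppr0 ?mulr0//.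
    rewrite negb_and -!ltNge; apply/orP; left.
    by rewrite mulrC subr_lt0 ltr_pdivrMr// mul1r.
  apply: le_lt_trans (energy_le_on beta p0 (ltW C'0) mBc mg1 mu_ H1 H0) _.
  apply: (@lt_le_trans _ _ ((C' `^ p)%:E * eu0%:E)%E); first by rewrite lte_pmul2l.
  rewrite -EFinM lee_fin -ler_pdivlMl// mulrC.
  by rewrite ge_min lexx orbT.
have eg2 : (energy p beta g2 < e2%:E)%E.
  apply: (@le_lt_trans _ _ ((l * (4 * C' / q)) `^ p)%:E); last by rewrite lte_fin.
  apply: (cutoff_layer_le p0 c0) => //; first by rewrite mulr_ge0 ?ltW.
  - move=> x /andP[cx xc].
    have x0 : 0 < x by apply: lt_le_trans cx; rewrite invr_gt0.
    have hb := hardy_bound p1 bp cu uv u0 x0 l0.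
    set k := (p - 1 - beta) / p in hb *.
    have ux : `|u x| <= x `^ k * (2 * (l / q)).
      rewrite -lee_fin; apply: (le_trans hb); rewrite [leRHS]EFinM; apply: lee_wpmul2l.
        by rewrite lee_fin powR_ge0.
      rewrite mulr_natl mulr2n EFinD leeD2l//.
      have -> : l / q = l `^ (1 - p) * e3 by rewrite /e3; field; rewrite !gt_eqF.
      rewrite EFinM; apply: lee_wpmul2l; first by rewrite lee_fin ltW.
      apply: (@le_trans _ _ ev0%:E); last by rewrite lee_fin ge_min lexx orbT.
      apply: le_trans (ltW Bv); apply: ge0_subset_integral => //.
      + by apply: measurableI => //; exact: measurable_Rplus.
      + by apply: measurable_funS (measurable_wpow p beta mv); [exact: measurable_Rplus|exact: subIsetl].
      + by move=> t _; rewrite lee_fin wpow_ge0.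
      + move=> t /=; rewrite in_itv/= => /andP[t0 tx]; split => //.
        by left => /=; rewrite in_itv/= (le_trans tx).
    rewrite powRD; last by rewrite (gt_eqF x0) implybT.
    rewrite powR_inv1 ?(ltW x0)// /g2 normrM.
    have cx2 : c <= 2 / x by rewrite ler_pdivlMr//; move: xc; rewrite ler_pdivlMr// mulrC.
    have hchi : `|chi2 x * derive1 chi1 x| <= 2 / x * C'.
      have /andP[h1 h2] := chi201 x; rewrite normrM (ger0_norm h1) d1.
      have /andP[h3 h4] := dth (c * x + -1).
      rewrite ger0_norm ?mulr_ge0 ?(ltW c0)// -[leRHS]mul1r; apply: ler_pM => //.
        by rewrite mulr_ge0// ltW.
      by apply: ler_pM; rewrite ?(ltW c0)// /C'; lra.
    have -> : l * (4 * C' / q) * (x `^ k * x^-1) =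
        (x `^ k * (2 * (l / q))) * (2 / x * C').
      by field; rewrite !gt_eqF.
    exact: ler_pM.
  - move=> x x0 xc; rewrite /g2 d1 (step_derive0 th0 th1) ?mulr0//.
    apply: contra xc => /andP[h1 h2]; apply/andP; split.
      by rewrite -[c^-1]mul1r ler_pdivrMr//; lra.
    by rewrite ler_pdivlMr//; lra.
have mvc : measurable_fun Rp (fun x => v x * chi x) by exact: measurable_funM.
have mg : measurable_fun Rp (fun x => v x * chi x + u x * derive1 chi x).
  apply: measurable_funD => //; apply: measurable_funM => //.
  exact: measurable_Rplus_cont (smooth_continuous (smooth_derive schi)).
apply: (energy_dist_lt p0 mv mvc mg).
  apply: le_lt_trans (cutE _ mv) _; apply: (lt_le_trans Bv).
  by rewrite lee_fin ge_min lexx.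
have -> : (fun x => v x * chi x) \- (fun x => v x * chi x + u x * derive1 chi x) =
    (fun x => - g1 x) \- g2.
  apply/funext => x /=; rewrite dchi /g1 /g2; ring.
have m0 : measurable_fun Rp (cst (0 : R)) by exact: measurable_cst.
have nrm f g : (forall x, `|f x| = `|g x|) -> energy p beta f = energy p beta g.
  by move=> fg; apply: eq_integral => x _; rewrite /wpow fg.
have mng1 : measurable_fun Rp (fun x => - g1 x) by exact: measurableT_comp.
have h1 : (energy p beta ((fun x => - g1 x) \- cst 0)%R < e2%:E)%E.
  by rewrite (nrm _ g1) // => x /=; rewrite subr0 normrN.
have h2 : (energy p beta (cst 0 \- g2)%R < e2%:E)%E.
  by rewrite (nrm _ g2) // => x /=; rewrite sub0r normrN.
exact: (energy_dist_lt p0 mng1 m0 mg2 h1 h2).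
Unshelve. all: by end_near. Qed.

End Cutoff.

(** * Both sets consist of the functions that vanish at 0 *)

Section Main.
Variable R : realType.
Implicit Types (u v : R -> R) (p alpha beta : R).

(** Cut off by [cutoff_energy], then approximate by [compact_density]. *)
Lemma small_near0_W1p0 p beta u : 1 < p -> beta < p - 1 -> W1p p beta u ->
  small_near0 u -> W1p0 p beta u.
Proof.
move=> p1 bp wu u0; split => // e e0; have p0 : 0 < p by lra.
have [W11u eu ev] := (W1pP _ _ p0).1 wu.
have [cu liu uv] := W11locP W11u; set v := weak_deriv u in uv ev.
pose e1 := (e / 2) `^ p.
have e20 : 0 < e / 2 by lra.
have e10 : 0 < e1 by rewrite powR_gt0.
pose e2 := e1 / (4 * 2 `^ p).
have e2p : 0 < e2 by rewrite divr_gt0// mulr_gt0// powR_gt0.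
have [chi [a [b [[a0 ab] [schi chi0] eu2 ev2]]]] :=
  cutoff_energy p1 bp cu uv u0 eu ev e2p.
have cchi := smooth_continuous schi.
set y := fun x => u x * chi x in eu2.
set z := fun x => v x * chi x + u x * derive1 chi x in ev2.
have yz : is_weak_deriv y z by exact: is_weak_derivM.
have cy x : 0 < x -> {for x, continuous y}.
  by move=> x0; apply: cvgM; [exact: cu|exact: cchi].
have y0 : supp_in a b y by move=> x /chi0; rewrite /y => ->; rewrite mulr0.
have z0 x : ~~ (a <= x <= b) -> z x = 0.
  move=> xab; rewrite /z (derive1_supp chi0 xab) chi0 ?mulr0 ?addr0//.
  by apply: contra xab => /andP[/ltW-> /ltW->].
have mu_ : measurable_fun (@Rplus R) u by case: liu.
have mv : measurable_fun (@Rplus R) v by case: uv => -[].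
have my : measurable_fun (@Rplus R) y by case: (loc_integrable_cont cy).
have mz : measurable_fun (@Rplus R) z by case: yz => -[].
have ez : (energy p beta z < +oo)%E.
  have -> : z = (z \- v) \+ v by apply/funext => x /=; rewrite subrK.
  apply: le_lt_trans (energyD beta p0 (measurable_funB mz mv) mv) _.
  rewrite lte_mul_pinfty ?lee_fin ?powR_ge0// lte_add_pinfty//.
  apply: le_lt_trans (ltry e2); apply: le_trans (ltW ev2).
  rewrite le_eqVlt; apply/orP; left; apply/eqP; apply: eq_integral => x _.
  by rewrite /wpow /= distrC.
have [phi [sphi phi0 eyp ezp]] := compact_density p1 bp a0 ab cy yz y0 z0 ez e2p.
have mphi := measurable_Rplus_cont (smooth_continuous sphi).
have mdphi := measurable_Rplus_cont (smooth_continuous (smooth_derive sphi)).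
exists phi.
  apply/test_funP; split => //; exists (a / 2), (b + 1); split => //.
    by rewrite divr_gt0.
  lra.
have [cd wd] := weak_deriv_sub_smooth W11u sphi.
have n1 : (wLp_norm p beta (u \- phi)%R < (e / 2)%:E)%E.
  by apply: wLp_norm_lt => //; exact: energy_dist_lt p0 mu_ my mphi eu2 eyp.
have n2 : (wLp_norm p beta (weak_deriv (u \- phi)%R) < (e / 2)%:E)%E.
  apply: wLp_norm_lt => //; rewrite (energy_weak_deriv _ _ cd wd).
  exact: energy_dist_lt p0 mv mz mdphi ev2 ezp.
by rewrite /W1p_norm [e in e%:E](splitr e) EFinD lteD.
Qed.

(** For [r < 1] the factor [r `^ sexp p alpha beta] is at least [1], its exponent
being negative. *)
Lemma Wab_sub_W1p0 p alpha beta : 1 < p -> -1 < alpha -> alpha < 0 ->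
  beta < `|alpha| * p - 1 -> Wab p alpha beta `<=` W1p0 p beta.
Proof.
move=> p1 a1 a0 bap u [wu lim0]; have p0 : 0 < p by lra.
have na : `|alpha| = - alpha by rewrite ltr0_norm.
have bp : beta < p - 1 by rewrite na in bap; nra.
apply: small_near0_W1p0 => // e d e0 d0.
have f0 t : 0 <= `|u t| * t `^ sexp p alpha beta by rewrite mulr_ge0 ?powR_ge0.
have d1 : 0 < Num.min 1 d by rewrite lt_min ltr01.
have [r /andP[r0 rd] ur] := (limf_einf_right0 f0).1 lim0 e (Num.min 1 d) e0 d1.
have [r1 rd'] : r < 1 /\ r < d by move: rd; rewrite lt_min => /andP[].
exists r; first by rewrite r0.
apply: le_lt_trans ur; rewrite -[leLHS]mulr1; apply: ler_wpM2l => //.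
have s0 : sexp p alpha beta <= 0.
  by rewrite /sexp ler_pdivrMr// mul0r; lra.
rewrite -(powRr0 r); apply: ger_powR => //; by rewrite r0 ltW.
Qed.

End Main.

Theorem mainTheorem5 (R : realType) (p alpha beta : R) :
  1 < p -> -1 < alpha -> alpha < 0 -> beta < `|alpha| * p - 1 ->
  Wab p alpha beta = W1p0 p beta /\
  (forall alpha' : R, -1 < alpha' -> alpha' < 0 -> beta < `|alpha'| * p - 1 ->
     Wab p alpha' beta = Wab p alpha beta).
Proof.
move=> p1 a1 a0 bap.
have key al : -1 < al -> al < 0 -> beta < `|al| * p - 1 ->
    Wab p al beta = W1p0 p beta.
  move=> al1 al0 bal; apply/seteqP; split; first exact: Wab_sub_W1p0.
  exact: W1p0_sub_Wab.
by split; [exact: key|move=> al al1 al0 bal; rewrite !key].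
Qed.
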